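(* If $M$ is a compact $d$-dimensional parallelizable manifold, then the graphical collection $\mathsf{FM}_M$ admits a natural structure of a right module over the contractad $\mathsf{FM}_d$.
   Context: Graphs and contractads. All graphs $\Gamma=(V_\Gamma,E_\Gamma)$ are finite, non-empty, simple, undirected and connected. A tube is a non-empty $G\subset V_\Gamma$ with $\Gamma|_G$ connected; it is nontrivial if $|G|\ge2$. $\Gamma/G$ is the simple graph obtained by contracting $G$ to a vertex $\{G\}$ (parallel edges identified). For a partition $I\vdash\Gamma$ of $V_\Gamma$ into tubes, $\Gamma/I$ contracts all blocks. Graphical collections of spaces (contravariant functors from the groupoid of connected graphs) have the product $(\mathcal P\circ\mathcal Q)(\Gamma)=\coprod_{I\vdash\Gamma}\mathcal P(\Gamma/I)\times\prod_{G\in I}\mathcal Q(\Gamma|_G)$; a contractad is a monoid for $\circ$, and a right $\mathcal P$-module is a graphical collection $\mathcal M$ with an associative unital action $\mathcal M\circ\mathcal P\to\mathcal M$, determined by maps $\circ^\Gamma_G:\mathcal M(\Gamma/G)\times\mathcal P(\Gamma|_G)\to\mathcal M(\Gamma)$. $\mathsf{FM}_d$. For a finite set $S$ put $W_S^d=(\mathbb R^d)^S/\mathbb R^d$ (quotient by the diagonal), $\mathbb S(V)=(V\setminus0)/\mathbb R_{>0}$. For $|V_\Gamma|\ge2$, $\mathsf{FM}_d(\Gamma)$ is the closure of the image of $\rho=\prod_G\rho_G:\mathrm{Conf}_\Gamma(\mathbb R^d)/(\mathbb R^d\rtimes\mathbb R_{>0})\to\prod_G\mathbb S(W^d_G)$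 over nontrivial tubes, where $\rho_G$ is the class of $(x_v)_{v\in G}$ and $\mathrm{Conf}_\Gamma(X)=\{(x_v)\in X^{V_\Gamma}:x_v\ne x_w\text{ for }(v,w)\in E_\Gamma\}$; it is a point for the one-vertex graph. Composition: the $K$-component of $\circ^\Gamma_G(a,b)$ is $\rho_K(b)$ for $K\subset G$, and $\mathbb S(j^K_G)(\rho_{K/G}(a))$ for $K\not\subset G$, where $K/G$ is the image of $K$ in $\Gamma/G$ and $j^K_G:W^d_{K/G}\to W^d_K$ repeats the coordinate of $\{G\}$ at all vertices of $K\cap G$. $\mathsf{FM}_M$. For a set $S$, $\mathrm{Bl}^{\mathbb R}_\triangle M^S$ is the spherical blow-up of $M^S$ along the small diagonal $\triangle(M)$: it is diffeomorphic to $M^S$ off the diagonal, and the diagonal is replaced by the sphere bundle of its normal bundle, $\mathbb S(TM^{\oplus S}/\triangle(TM))$ (the exceptional divisor). $\mathsf{FM}_M(\Gamma)$ is the closure of the image of $\mathrm{Conf}_\Gamma(M)\to M^{V_\Gamma}\times\prod_G\mathrm{Bl}^{\mathbb R}_\triangle M^{G}$, product over nontrivial tubes $G$ of $\Gamma$ (including $V_\Gamma$). ''Natural structure''. Fix a trivialization $TM\cong M\times\mathbb R^d$, so the exceptional divisor of $\mathrm{Bl}^{\mathbb R}_\triangle M^{S}$ is $M\times\mathbb S(W^d_S)$. The action meant is $\circ^\Gamma_G:\mathsf{FM}_M(\Gamma/G)\times\mathsf{FM}_d(\Gamma|_G)\to\mathsf{FM}_M(\Gamma)$ whose component at a tube $K\subset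 G$ is the point of the exceptional divisor $M\times\mathbb S(W_K^d)$ given by the $\{G\}$-th point of the first argument and $\rho_K$ of the second, and whose component at $K\not\subset G$ is the image of the $K/G$-component of the first argument under the inclusion $\mathrm{Bl}^{\mathbb R}_\triangle M^{K/G}\to\mathrm{Bl}^{\mathbb R}_\triangle M^K$ induced by repeating the coordinate of $\{G\}$ at all vertices of $K\cap G$ (and by $\mathbb S(j^K_G)$ on exceptional fibres); on $M^{V_\Gamma}$ one repeats the $\{G\}$-th point over $G$. *)

(* Defs.v *)
From HB Require Import structures.
From mathcomp Require Import all_boot all_order all_algebra.
From mathcomp Require Import generic_quotient.

Set Implicit Arguments.
Unset Strict Implicit.
Unset Printing Implicit Defensive.

Import Order.TTheory GRing.Theory Num.Theory.

Definition is_connected (T : finType) (e : rel T) : bool :=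
  [forall x, [forall y, connect e x y]].

Record graph := Graph {
  vertex :> finType;
  edge : rel vertex;
  edge_sym : symmetric edge;
  edge_irrefl : irreflexive edge;
  vertex_nonempty : (0 < #|vertex|)%N;
  graph_connected : is_connected edge }.
Arguments edge {g} : rename.

Lemma is_connected_surj (S T : finType) (e : rel S) (e' : rel T) (f : S -> T) :
  (forall t, exists s, f s = t) ->
  (forall x y, e x y -> f x = f y \/ e' (f x) (f y)) ->
  is_connected e -> is_connected e'.
Proof.
move=> sf hf /forallP ce; apply/forallP => t; apply/forallP => t'.
have [s <-] := sf t; have [s' <-] := sf t'.
have /forallP/(_ s')/connectP[p + ->] := ce s.
elim: p s => [|x p IHp] s //= /andP[/hf sx /IHp]; case: sx => [->|sx] //.
by apply: connect_trans; exact: connect1.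
Qed.

Definition ssub (T : finType) (G : {set T}) : finType := {v : T | v \in G}.

Definition induced_edge (Γ : graph) (G : {set Γ}) : rel (ssub G) :=
  fun x y => edge (val x) (val y).

Definition is_tube (Γ : graph) (G : {set Γ}) : bool :=
  (0 < #|G|)%N && is_connected (@induced_edge Γ G).

Definition tube (Γ : graph) := {G : {set Γ} | is_tube G}.

Definition nttube (Γ : graph) := {G : {set Γ} | is_tube G && (1 < #|G|)%N}.

Section induced.
Variables (Γ : graph) (G : tube Γ).
Let e := @induced_edge Γ (val G).

Lemma induced_sym : symmetric e.
Proof. by move=> x y; rewrite /e /induced_edge edge_sym. Qed.

Lemma induced_irrefl : irreflexive e.
Proof. by move=> x; rewrite /e /induced_edge edge_irrefl. Qed.

Lemma induced_nonempty : (0 < #|ssub (val G)|)%N.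
Proof. by rewrite card_sig; case: G => A /= /andP[]. Qed.

Lemma induced_connected : is_connected e.
Proof. by rewrite /e; case: G => A /= /andP[]. Qed.

Definition induced_graph : graph :=
  Graph induced_sym induced_irrefl induced_nonempty induced_connected.

End induced.

Definition is_tpart (Γ : graph) (I : {set {set Γ}}) : bool :=
  partition I [set: Γ] && [forall G in I, is_tube G].

Definition tpart (Γ : graph) := {I : {set {set Γ}} | is_tpart I}.

Definition block (Γ : graph) (I : tpart Γ) : finType :=
  {G : {set Γ} | G \in val I}.

Section tpart_theory.
Variables (Γ : graph) (I : tpart Γ).

Lemma block_is_tube (G : block I) : is_tube (val G).
Proof.
by case: I G => J /= /andP[_ /forallP h] [A /= hA]; have /implyP := h A; exact.
Qed.

Definition block_tube (G : block I) : tube Γ := exist _ (val G) (block_is_tube G).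

Lemma tpartP : partition (val I) [set: Γ].
Proof. by case: I => J /= /andP[]. Qed.

Lemma pblock_in (v : Γ) : pblock (val I) v \in val I.
Proof.
by apply: pblock_mem; have /andP[/eqP -> _] := tpartP; rewrite inE.
Qed.

Definition cls (v : Γ) : block I := exist _ (pblock (val I) v) (pblock_in v).

Lemma mem_cls (v : Γ) : v \in val (cls v).
Proof. by rewrite /= mem_pblock; have /andP[/eqP -> _] := tpartP; rewrite inE. Qed.

Lemma cls_eqP (v : Γ) (G : block I) : reflect (cls v = G) (v \in val G).
Proof.
apply: (iffP idP) => [vG|<-]; last exact: mem_cls.
apply: val_inj => /=; apply: def_pblock vG; last exact: (valP G).
by have /and3P[] := tpartP.
Qed.

Lemma block_inhabited (G : block I) : exists v : Γ, v \in val G.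
Proof.
by have /andP[/card_gt0P[v vG] _] := block_is_tube G; exists v.
Qed.

Definition pickin (G : block I) : Γ := xchoose (block_inhabited G).

Lemma pickin_in (G : block I) : pickin G \in val G.
Proof. exact: xchooseP. Qed.

Lemma cls_pickin (G : block I) : cls (pickin G) = G.
Proof. exact/cls_eqP/pickin_in. Qed.

Definition quot_edge : rel (block I) := fun G H =>
  (G != H) && [exists x in val G, [exists y in val H, edge x y]].

Lemma quot_sym : symmetric quot_edge.
Proof.
move=> G H; rewrite /quot_edge eq_sym; congr (_ && _).
by apply/exists_inP/exists_inP => -[x xG /exists_inP[y yH xy]]; exists y => //;
   apply/exists_inP; exists x => //; rewrite edge_sym.
Qed.

Lemma quot_irrefl : irreflexive quot_edge.
Proof. by move=> G; rewrite /quot_edge eqxx. Qed.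

Lemma quot_nonempty : (0 < #|block I|)%N.
Proof.
have /card_gt0P[v _] := vertex_nonempty Γ.
by apply/card_gt0P; exists (cls v).
Qed.

Lemma cls_edge (x y : Γ) : edge x y -> cls x = cls y \/ quot_edge (cls x) (cls y).
Proof.
move=> xy; have [->|ne] := eqVneq (cls x) (cls y); [by left|right].
rewrite /quot_edge ne; apply/exists_inP; exists x; first exact: mem_cls.
by apply/exists_inP; exists y => //; exact: mem_cls.
Qed.

Lemma quot_connected : is_connected quot_edge.
Proof.
apply: (is_connected_surj _ cls_edge (graph_connected Γ)) => G.
by exists (pickin G); exact: cls_pickin.
Qed.

Definition quot_graph : graph := Graph quot_sym quot_irrefl quot_nonempty quot_connected.

End tpart_theory.

Section fibres.
Variables (Γ : graph) (T : eqType) (f : Γ -> T).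

Definition fibre (v : Γ) : {set Γ} := [set w | f v == f w].

Lemma fibre_rel : {in [set: Γ] & &, equivalence_rel [rel x y | f x == f y]}.
Proof. by move=> x y z _ _ _ /=; split=> // /eqP ->. Qed.

Lemma fibre_partition_proof (h : forall v, is_tube (fibre v)) :
  is_tpart (preim_partition f [set: Γ]).
Proof.
apply/andP; split; first exact: preim_partitionP.
apply/forall_inP => G /imsetP[v _ ->]; move: (h v); rewrite /fibre.
by congr is_tube; apply/setP => w; rewrite !inE.
Qed.

Definition fibre_partition (h : forall v, is_tube (fibre v)) : tpart Γ :=
  exist _ (preim_partition f [set: Γ]) (fibre_partition_proof h).

Lemma fibre_partitionE h (x y : Γ) :
  (y \in val (cls (fibre_partition h) x)) = (f x == f y).
Proof.
by rewrite /= pblock_equivalence_partition ?inE//; exact: fibre_rel.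
Qed.

Lemma fibre_clsP h (x y : Γ) :
  cls (fibre_partition h) x = cls (fibre_partition h) y <-> f x = f y.
Proof.
split=> [xy|/eqP fxy]; last by apply/cls_eqP; rewrite fibre_partitionE eq_sym.
by apply/eqP; rewrite -(fibre_partitionE h) xy; exact: mem_cls.
Qed.

End fibres.

Record giso (Γ Δ : graph) := GIso {
  gfun :> Γ -> Δ;
  gfun_bij : bijective gfun;
  gfun_edge : forall x y, edge (gfun x) (gfun y) = edge x y }.

Definition giso_id (Γ : graph) : giso Γ Γ :=
  @GIso Γ Γ id (inv_bij (@erefl _)) (fun x y => erefl).

Lemma giso_comp_edge (Γ Δ Λ : graph) (g : giso Δ Λ) (f : giso Γ Δ) (x y : Γ) :
  edge ((g \o f) x) ((g \o f) y) = edge x y.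
Proof. by rewrite /= !gfun_edge. Qed.

Definition giso_comp (Γ Δ Λ : graph) (g : giso Δ Λ) (f : giso Γ Δ) : giso Γ Λ :=
  GIso (bij_comp (gfun_bij g) (gfun_bij f)) (giso_comp_edge g f).

Section graph1.
Let e : rel unit := fun _ _ => false.
Let e_sym : symmetric e. Proof. by []. Qed.
Let e_irr : irreflexive e. Proof. by []. Qed.
Let e_ne : (0 < #|{: unit}|)%N. Proof. by rewrite card_unit. Qed.
Let e_conn : is_connected e.
Proof. by apply/forallP => -[]; apply/forallP => -[]; exact: connect0. Qed.
Definition graph1 : graph := Graph e_sym e_irr e_ne e_conn.
End graph1.

Section iso1.
Variables (Γ : graph) (Γ1 : #|Γ| = 1%N).
Let f : Γ -> graph1 := fun=> tt.
Let all_eq (x y : Γ) : x = y.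
Proof. by have /fintype_le1P/(_ y x) : (#|Γ| <= 1)%N by rewrite Γ1. Qed.
Let f_bij : bijective f.
Proof.
have /card_gt0P[v _] := vertex_nonempty Γ.
by apply: (@Bijective _ _ f (fun=> v)) => [x|x]; [exact: all_eq|case: x].
Qed.
Let f_edge x y : edge (f x) (f y) = edge x y.
Proof. by rewrite (all_eq y x) !edge_irrefl. Qed.
Definition iso1 : giso Γ graph1 := GIso f_bij f_edge.
End iso1.

Section induced_iso.
Variables (Γ Δ : graph) (f : Γ -> Δ).
Hypothesis f_inj : injective f.
Hypothesis f_edge : forall x y, edge (f x) (f y) = edge x y.
Variables (A : tube Γ) (B : tube Δ).
Hypothesis f_mem : forall v, (v \in val A) = (f v \in val B).
Hypothesis f_surj : forall w, w \in val B -> exists v, f v = w.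

Let in_B (x : induced_graph A) : f (val x) \in val B.
Proof. by rewrite -f_mem; exact: (valP x). Qed.
Let g (x : induced_graph A) : induced_graph B := exist _ (f (val x)) (in_B x).
Let g_bij : bijective g.
Proof.
apply: inj_card_bij; first by move=> x y /(congr1 val)/f_inj/val_inj.
have sB : {subset val B <= [seq f x | x in val A]}.
  move=> w wB; have [v vw] := f_surj wB; apply/mapP; exists v => //.
  by rewrite mem_enum f_mem vw.
rewrite /= !card_sig.
by apply: leq_trans (leq_image_card f (val A)); apply: subset_leq_card; apply/fintype.subsetP.
Qed.
Let g_edge x y : edge (g x) (g y) = edge x y.
Proof. exact: f_edge. Qed.
Definition induced_iso : giso (induced_graph A) (induced_graph B) := GIso g_bij g_edge.
End induced_iso.

Section quot_iso.
Variables (Γ Δ : graph) (f : Γ -> Δ).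
Hypothesis h : forall v, is_tube (fibre f v).
Hypothesis f_surj : forall w, exists v, f v = w.
Hypothesis f_edge : forall x y, edge x y -> f x = f y \/ edge (f x) (f y).
Hypothesis f_lift : forall a b, edge a b ->
  exists x y, [/\ f x = a, f y = b & edge x y].
Let I := fibre_partition h.

Let g (G : quot_graph I) : Δ := f (pickin G).
Let gE (v : Γ) : g (cls I v) = f v.
Proof. by apply/(fibre_clsP h); exact: cls_pickin. Qed.
Let g_bij : bijective g.
Proof.
apply: inj_card_bij.
  by move=> G H /(fibre_clsP h); rewrite !cls_pickin.
rewrite -[leqRHS]/(#|predT|); apply: leq_trans (leq_image_card g predT).
apply/subset_leq_card/fintype.subsetP => w _; have [v <-] := f_surj w.
by apply/mapP; exists (cls I v); rewrite ?mem_enum ?gE.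
Qed.
Let g_edge x y : edge (g x) (g y) = edge x y.
Proof.
apply/idP/idP => [xy|/andP[ne /exists_inP[v vx /exists_inP[w wy vw]]]].
  have [v [w [vx wy vw]]] := f_lift xy.
  have vE : cls I v = x by rewrite -(cls_pickin x); apply/(fibre_clsP h).
  have wE : cls I w = y by rewrite -(cls_pickin y); apply/(fibre_clsP h).
  have [vw'|] := @cls_edge _ I _ _ vw; last by rewrite vE wE.
  by move: xy; rewrite -vE -wE vw' edge_irrefl.
have [xE yE] : cls I v = x /\ cls I w = y by split; apply/cls_eqP.
rewrite -xE -yE !gE; have [fe|//] := f_edge vw.
by case/negP: ne; rewrite -xE -yE; apply/eqP/(fibre_clsP h).
Qed.
Definition quot_iso : giso (quot_graph I) Δ := GIso g_bij g_edge.
Lemma quot_isoE (v : Γ) : quot_iso (cls I v) = f v.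
Proof. exact: gE. Qed.
End quot_iso.

Lemma connect_homo (S T : finType) (e : rel S) (e' : rel T) (f : S -> T) :
  (forall x y, e x y -> f x = f y \/ e' (f x) (f y)) ->
  forall x y, connect e x y -> connect e' (f x) (f y).
Proof.
move=> hf x y /connectP[p + ->].
elim: p x => [|z p IHp] x //= /andP[/hf xz /IHp]; case: xz => [->|xz] //.
by apply: connect_trans; exact: connect1.
Qed.

Lemma is_connected_lift (S T : finType) (e : rel S) (e' : rel T) (f : S -> T) :
  (forall t t', e' t t' -> exists s s', [/\ f s = t, f s' = t' & e s s']) ->
  (forall s s', f s = f s' -> connect e s s') ->
  is_connected e' -> is_connected e.
Proof.
move=> lf ff /forallP ce; apply/forallP => x; apply/forallP => y.
have /forallP/(_ (f y))/connectP[p] := ce (f x).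
elim: p x => [|t p IHp] x /=; first by move=> _ /esym/ff.
move=> /andP[/lf[s [s' [sx s't ss']]]] + pE; rewrite -s't in pE *.
move=> /IHp/(_ pE); apply: connect_trans.
by apply: (connect_trans (ff _ _ (esym sx))); exact: connect1.
Qed.

Section tubes.
Variable Γ : graph.

Lemma is_tube1 (v : Γ) : is_tube [set v].
Proof.
rewrite /is_tube cards1 /=; apply/forallP => -[x xv]; apply/forallP => -[y yv].
rewrite (_ : exist _ x xv = exist _ y yv) ?connect0//.
by apply: val_inj => /=; move: xv yv; rewrite !inE => /eqP-> /eqP->.
Qed.

Lemma is_tubeT : is_tube [set: Γ].
Proof.
rewrite /is_tube cardsT vertex_nonempty /=.
have mT (v : Γ) : v \in [set: Γ] by rewrite inE.
apply: (@is_connected_surj _ _ _ _ (fun v : Γ => exist _ v (mT v) : ssub [set: Γ])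
  _ _ (graph_connected Γ)).
  by move=> [v vT]; exists v; exact: val_inj.
by move=> x y xy; right.
Qed.

Lemma is_tube_image (Δ : graph) (f : Γ -> Δ) (K : {set Γ}) :
  (forall x y, edge x y -> f x = f y \/ edge (f x) (f y)) ->
  is_tube K -> is_tube (f @: K).
Proof.
move=> hf /andP[/card_gt0P[v vK] cK]; apply/andP; split.
  by apply/card_gt0P; exists (f v); exact: imset_f.
pose g (x : ssub K) : ssub (f @: K) := exist _ (f (val x)) (imset_f f (valP x)).
apply: (is_connected_surj (f := g) _ _ cK).
  move=> [w wK]; have /imsetP[x xK wE] := wK.
  by exists (exist _ x xK); apply: val_inj => /=.
by move=> x y /hf[fxy|fxy]; [left; exact: val_inj|right].
Qed.

End tubes.

Section basic_partitions.
Variable Γ : graph.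

Lemma top_fibre (v : Γ) : is_tube (fibre (fun _ : Γ => tt : graph1) v).
Proof. by rewrite /fibre; under eq_finset do rewrite eqxx; exact: is_tubeT. Qed.

Lemma disc_fibre (v : Γ) : is_tube (fibre id v).
Proof.
rewrite /fibre (_ : [set w | _] = [set v]); first exact: is_tube1.
by apply/setP => w; rewrite !inE eq_sym.
Qed.

Definition ptop : tpart Γ := fibre_partition top_fibre.
Definition pdisc : tpart Γ := fibre_partition disc_fibre.

Lemma ptop_surj (w : graph1) : exists v : Γ, tt = w.
Proof. by case: w; have /card_gt0P[v _] := vertex_nonempty Γ; exists v. Qed.

Definition ptop_iso : giso (quot_graph ptop) graph1 :=
  @quot_iso Γ graph1 _ top_fibre ptop_surj
    (fun _ _ _ => or_introl erefl) (fun _ _ (ab : false) => False_ind _ (notF ab)).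

Lemma pdisc_lift (a b : Γ) : edge a b -> exists x y, [/\ x = a, y = b & edge x y].
Proof. by move=> ab; exists a, b. Qed.

Definition pdisc_iso : giso (quot_graph pdisc) Γ :=
  @quot_iso Γ Γ id disc_fibre (fun w => ex_intro _ w erefl)
    (fun _ _ xy => or_intror xy) pdisc_lift.

Lemma pdisc_card (G : block pdisc) : #|induced_graph (block_tube G)| = 1%N.
Proof.
rewrite card_sig /=.
have -> : val G = [set pickin G]; last exact: cards1.
rewrite -{1}(cls_pickin G); apply/setP => w.
by rewrite fibre_partitionE !inE eq_sym.
Qed.

Lemma ptop_blockE (G : block ptop) (v : Γ) : v \in val G.
Proof. by rewrite -(cls_pickin G) fibre_partitionE. Qed.

Lemma ptop_induced_bij (G : block ptop) :
  bijective (val : induced_graph (block_tube G) -> Γ).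
Proof.
by exists (fun v => exist _ v (ptop_blockE G v)) => // x; exact: val_inj.
Qed.

Definition ptop_induced_iso (G : block ptop) : giso (induced_graph (block_tube G)) Γ :=
  @GIso (induced_graph (block_tube G)) Γ val (ptop_induced_bij G) (fun _ _ => erefl).

(* The partition whose only possibly nontrivial block is the tube [G]; its
   quotient is the contraction [Γ/G]. *)
Variable G : tube Γ.
Definition collapse (v : Γ) : option Γ := if v \in val G then None else Some v.

Lemma collapse_fibre (v : Γ) : is_tube (fibre collapse v).
Proof.
rewrite /fibre /collapse; case: ifPn => vG.
  rewrite (_ : [set w | _] = val G); first exact: (valP G).
  by apply/setP => w; rewrite !inE; case: ifP.
rewrite (_ : [set w | _] = [set v]); first exact: is_tube1.
apply/setP => w; rewrite !inE; case: ifPn => [wG|_].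
  by apply/esym/negbTE; apply: contra vG => /eqP <-.
by apply/eqP/eqP => [[]|->].
Qed.

Definition psingle : tpart Γ := fibre_partition collapse_fibre.

Lemma psingle_mem : val G \in val psingle.
Proof.
have /andP[/card_gt0P[v vG] _] := valP G.
rewrite (_ : val G = val (cls psingle v)); first exact: (valP (cls psingle v)).
apply/setP => w; rewrite fibre_partitionE /collapse vG.
by case: ifP.
Qed.

(* The vertex [{G}] of [Γ/G]. *)
Definition vertexG : quot_graph psingle := exist _ (val G) psingle_mem.

Lemma psingle_card (H : block psingle) : val H != val G ->
  #|induced_graph (block_tube H)| = 1%N.
Proof.
move=> HG; rewrite card_sig /=.
have -> : val H = [set pickin H]; last exact: cards1.
have nG : pickin H \notin val G.
  apply: contra HG => hG; apply/eqP.
  have /cls_eqP <- := pickin_in H.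
  by have /cls_eqP -> : pickin H \in val vertexG by [].
rewrite -{1}(cls_pickin H); apply/setP => w.
rewrite fibre_partitionE !inE /collapse (negbTE nG).
case: ifPn => [wG|_]; first by apply/esym/negbTE; apply: contra nG => /eqP <-.
by apply/eqP/eqP => [[]|->].
Qed.

Definition induced_eq_giso (A B : tube Γ) (AB : val A = val B) :
    giso (induced_graph A) (induced_graph B) :=
  @induced_iso Γ Γ id (@inj_id _) (fun _ _ => erefl) A B
    (fun v => congr1 (fun X : {set Γ} => v \in X) AB)
    (fun w _ => ex_intro _ w erefl).

End basic_partitions.

Section pull.
Variables (Γ Δ : graph) (f : giso Γ Δ) (I : tpart Δ).
Let q : Γ -> quot_graph I := fun v => cls I (f v).

Lemma pull_fibre (v : Γ) : is_tube (fibre q v).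
Proof.
have [g fK gK] := gfun_bij f.
rewrite (_ : fibre q v = g @: val (cls I (f v))).
  apply: is_tube_image; last exact: (block_is_tube (cls I (f v))).
  by move=> x y xy; right; rewrite -(gfun_edge f) !gK.
apply/setP => w; rewrite !inE; apply/eqP/imsetP => [vw|[x xv ->]].
  exists (f w); last by rewrite fK.
  by apply/cls_eqP; rewrite -[LHS]/(q w) -vw.
by rewrite /q gK; have /cls_eqP -> := xv.
Qed.

Definition ppull : tpart Γ := fibre_partition pull_fibre.

Lemma ppull_surj (G : quot_graph I) : exists v, q v = G.
Proof.
by have [g fK gK] := gfun_bij f; exists (g (pickin G)); rewrite /q gK cls_pickin.
Qed.

Lemma ppull_edge (x y : Γ) : edge x y -> q x = q y \/ edge (q x) (q y).
Proof. by move=> xy; apply: cls_edge; rewrite gfun_edge. Qed.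

Lemma ppull_lift (G H : quot_graph I) : edge G H ->
  exists x y, [/\ q x = G, q y = H & edge x y].
Proof.
have [g fK gK] := gfun_bij f.
move=> /andP[_ /exists_inP[x xG /exists_inP[y yH xy]]].
exists (g x), (g y); rewrite /q !gK -(gfun_edge f) !gK.
by split=> //; exact/cls_eqP.
Qed.

Definition ppull_iso : giso (quot_graph ppull) (quot_graph I) :=
  quot_iso pull_fibre ppull_surj ppull_edge ppull_lift.

Lemma ppull_mem (H : block ppull) (v : Γ) :
  (v \in val H) = (f v \in val (ppull_iso H)).
Proof.
rewrite -(cls_pickin H) fibre_partitionE quot_isoE.
by apply/eqP/cls_eqP => [->|<-].
Qed.

Lemma giso_surj (w : Δ) : exists v, f v = w.
Proof. by have [g _ gK] := gfun_bij f; exists (g w). Qed.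

Definition ppull_induced_iso (H : block ppull) :
    giso (induced_graph (block_tube H)) (induced_graph (block_tube (ppull_iso H))) :=
  @induced_iso Γ Δ f (bij_inj (gfun_bij f)) (gfun_edge f)
    (block_tube H) (block_tube (ppull_iso H)) (ppull_mem H)
    (fun w _ => giso_surj w).

End pull.

(* For a partition [I] of [Γ] and a partition [J] of [Γ/I]: the partition [IJ]
   of [Γ] with [Γ/IJ ≅ (Γ/I)/J], and the partitions induced by [I] on the
   blocks of [IJ]. *)
Section refine.
Variables (Γ : graph) (I : tpart Γ) (J : tpart (quot_graph I)).
Let q : Γ -> quot_graph J := fun v => cls J (cls I v).

Lemma prefine_surj (G : quot_graph J) : exists v, q v = G.
Proof. by exists (pickin (pickin G : quot_graph I)); rewrite /q !cls_pickin. Qed.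

Lemma prefine_edge (x y : Γ) : edge x y -> q x = q y \/ edge (q x) (q y).
Proof.
by move=> /(@cls_edge _ I)[xy|/(@cls_edge _ J)//]; left; rewrite /q xy.
Qed.

Lemma prefine_lift (G H : quot_graph J) : edge G H ->
  exists x y, [/\ q x = G, q y = H & edge x y].
Proof.
move=> /andP[_ /exists_inP[A AG /exists_inP[B BH]]].
move=> /andP[_ /exists_inP[x xA /exists_inP[y yB xy]]].
exists x, y; split=> //; rewrite /q.
  by move/cls_eqP: xA => ->; exact/cls_eqP.
by move/cls_eqP: yB => ->; exact/cls_eqP.
Qed.

Lemma prefine_fibre (v : Γ) : is_tube (fibre q v).
Proof.
apply/andP; split; first by apply/card_gt0P; exists v; rewrite inE.
pose B := cls J (cls I v).
have memB (x : ssub (fibre q v)) : cls I (val x) \in val B.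
  by apply/cls_eqP; have := valP x; rewrite inE => /eqP.
pose f (x : ssub (fibre q v)) : ssub (val B) := exist _ (cls I (val x)) (memB x).
have memF (w : Γ) (A : ssub (val B)) : w \in val (val A) -> w \in fibre q v.
  rewrite inE /q => /cls_eqP ->; apply/eqP/esym/cls_eqP; exact: (valP A).
apply: (is_connected_lift (f := f) (e' := @induced_edge _ (val B))).
- move=> A A' /andP[_ /exists_inP[x xA /exists_inP[y yA xy]]].
  exists (exist _ x (memF _ _ xA)), (exist _ y (memF _ _ yA)).
  by split=> //; apply: val_inj => /=; apply/cls_eqP.
- move=> x y /(congr1 val)/= xy.
  pose A : ssub (val B) := exist _ (cls I (val x)) (memB x).
  have xA : val x \in val (val A) by exact: mem_cls.
  have yA : val y \in val (val A) by apply/cls_eqP; exact: esym xy.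
  pose g (z : ssub (val (val A))) : ssub (fibre q v) :=
    exist _ (val z) (memF _ _ (valP z)).
  have -> : x = g (exist _ (val x) xA) by exact: val_inj.
  have -> : y = g (exist _ (val y) yA) by exact: val_inj.
  apply: (@connect_homo _ _ (@induced_edge Γ (val (val A)))).
    by move=> z z' zz'; right.
  by have /andP[_ /forallP/(_ (exist _ (val x) xA))/forallP] :=
    block_is_tube (cls I (val x)); apply.
- exact: (graph_connected (induced_graph (block_tube B))).
Qed.

Definition prefine : tpart Γ := fibre_partition prefine_fibre.

Definition prefine_iso : giso (quot_graph prefine) (quot_graph J) :=
  quot_iso prefine_fibre prefine_surj prefine_edge prefine_lift.

Lemma prefine_mem (H : block prefine) (v : Γ) :
  (v \in val H) = (cls I v \in val (prefine_iso H)).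
Proof.
rewrite -(cls_pickin H) fibre_partitionE quot_isoE.
by apply/eqP/cls_eqP => [->|<-].
Qed.

Section restrict.
Variable H : block prefine.
Let ΓH := induced_graph (block_tube H).
Let B := block_tube (prefine_iso H).

Lemma prestr_in (x : ΓH) : cls I (val x) \in val B.
Proof. by rewrite /= -prefine_mem; exact: (valP x). Qed.

Let r (x : ΓH) : induced_graph B := exist _ (cls I (val x)) (prestr_in x).

Let in_H (v : Γ) (A : induced_graph B) : v \in val (val A) -> v \in val H.
Proof. by move=> /cls_eqP vA; rewrite prefine_mem vA; exact: (valP A). Qed.

Lemma prestr_surj (A : induced_graph B) : exists x, r x = A.
Proof.
by exists (exist _ (pickin (val A)) (in_H (pickin_in (val A))));
  apply: val_inj => /=; rewrite cls_pickin.
Qed.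

Lemma prestr_edge (x y : ΓH) : edge x y -> r x = r y \/ edge (r x) (r y).
Proof.
by move=> /(@cls_edge _ I)[xy|xy]; [left; exact: val_inj|right].
Qed.

Lemma prestr_lift (A A' : induced_graph B) : edge A A' ->
  exists x y, [/\ r x = A, r y = A' & edge x y].
Proof.
move=> /andP[_ /exists_inP[x xA /exists_inP[y yA xy]]].
exists (exist _ x (in_H xA)), (exist _ y (in_H yA)).
by split=> //; apply: val_inj => /=; apply/cls_eqP.
Qed.

Lemma prestr_fibre (x : ΓH) : is_tube (fibre r x).
Proof.
have xF : x \in fibre r x by rewrite inE.
apply/andP; split; first by apply/card_gt0P; exists x.
pose A := r x.
have memA (z : ssub (val (val A))) : val z \in val H := in_H (valP z).
pose g0 (z : ssub (val (val A))) : ΓH := exist _ (val z) (memA z).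
have memF z : g0 z \in fibre r x.
  rewrite inE; apply/eqP/val_inj => /=; apply/esym/cls_eqP; exact: (valP z).
pose g (z : ssub (val (val A))) : ssub (fibre r x) := exist _ (g0 z) (memF z).
have /andP[_ cA] := block_is_tube (val A).
apply: (is_connected_surj (f := g) _ _ cA); last by move=> z z' zz'; right.
move=> [y yF]; have yA : val y \in val (val A).
  by apply/cls_eqP; move: yF; rewrite inE => /eqP/(congr1 val).
by exists (exist _ (val y) yA); do 2!apply: val_inj => /=.
Qed.

Definition prestr : tpart ΓH := fibre_partition prestr_fibre.

(* [(Γ|_H)/(I|_H) ≅ (Γ/I)|_B] *)
Definition prestr_iso : giso (quot_graph prestr) (induced_graph B) :=
  quot_iso prestr_fibre prestr_surj prestr_edge prestr_lift.

Lemma prestr_mem (K : block prestr) (x : ΓH) :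
  (x \in val K) = (val x \in val (val (prestr_iso K))).
Proof.
rewrite -(cls_pickin K) fibre_partitionE quot_isoE.
by apply/eqP/cls_eqP => [->|xE] //; apply: val_inj => /=; rewrite xE.
Qed.

Lemma prestr_val_surj (K : block prestr) (w : Γ) :
  w \in val (val (prestr_iso K)) -> exists x : ΓH, val x = w.
Proof. by move=> /in_H wH; exists (exist _ w wH). Qed.

(* [(Γ|_H)|_K ≅ Γ|_K] *)
Definition prestr_induced_iso (K : block prestr) :
    giso (induced_graph (block_tube K)) (induced_graph (block_tube (val (prestr_iso K)))) :=
  @induced_iso ΓH Γ val val_inj (fun _ _ => erefl)
    (block_tube K) (block_tube (val (prestr_iso K)))
    (prestr_mem K) (@prestr_val_surj K).

End restrict.
End refine.

Section tube_image.
Variables (S T : finType) (f : S -> T).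

Definition imfun (K : {set S}) (v : ssub K) : ssub (f @: K) :=
  exist _ (f (val v)) (imset_f f (valP v)).

Lemma imfun_surj (K : {set S}) (w : ssub (f @: K)) : exists v, imfun v = w.
Proof.
case: w => w wK; have /imsetP[v vK wE] := wK.
by exists (exist _ v vK); exact: val_inj.
Qed.
End tube_image.

Lemma nttube_image (Γ Δ : graph) (f : giso Γ Δ) (K : nttube Γ) :
  is_tube (f @: val K) && (1 < #|f @: val K|)%N.
Proof.
have /andP[tK cK] := valP K.
rewrite card_imset; last exact: bij_inj (gfun_bij f).
by rewrite cK is_tube_image// => x y xy; right; rewrite gfun_edge.
Qed.

Definition imtube (Γ Δ : graph) (f : giso Γ Δ) (K : nttube Γ) : nttube Δ :=
  exist _ (f @: val K) (nttube_image f K).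

Section tubes_of_contraction.
Variables (Γ : graph) (G : tube Γ).
Let π : Γ -> quot_graph (psingle G) := cls (psingle G).

Lemma nttube_quot (K : nttube Γ) : ~~ (val K \subset val G) ->
  is_tube (π @: val K) && (1 < #|π @: val K|)%N.
Proof.
move=> /subsetPn[v vK vG]; have /andP[tK cK] := valP K.
have tI : is_tube (π @: val K).
  by apply: is_tube_image tK => x y; exact: (@cls_edge _ (psingle G)).
rewrite tI /=.
have [w wK wv] : exists2 w, w \in val K & w != v.
  move: cK; rewrite (cardsD1 v) vK ltnS => /card_gt0P[w].
  by rewrite !inE => /andP[wv wK]; exists w.
have: [set π v; π w] \subset π @: val K.
  by apply/fintype.subsetP => z /set2P[] ->; exact: imset_f.
move=> /subset_leq_card; apply: leq_trans; rewrite cards2.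
suff -> : π v != π w by [].
apply/eqP => /fibre_clsP; rewrite /collapse (negbTE vG).
by case: ifP => // _ [vw]; move: wv; rewrite vw eqxx.
Qed.

(* [K/G], for a tube [K] not contained in [G] *)
Definition quot_tube (K : nttube Γ) (KG : ~~ (val K \subset val G)) :
  nttube (quot_graph (psingle G)) := exist _ (π @: val K) (nttube_quot KG).

Definition sub_tube_set (K : nttube Γ) : {set induced_graph G} :=
  [set v | val v \in val K].

Lemma sub_tube_in (K : nttube Γ) (KG : val K \subset val G) (v : ssub (val K)) :
  val v \in val G.
Proof. by have /fintype.subsetP := KG; apply; exact: (valP v). Qed.

Lemma sub_tube_mem (K : nttube Γ) (KG : val K \subset val G) (v : ssub (val K)) :
  (exist _ (val v) (sub_tube_in KG v) : induced_graph G) \in sub_tube_set K.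
Proof. by rewrite inE; exact: (valP v). Qed.

Definition sub_tube_fun (K : nttube Γ) (KG : val K \subset val G)
    (v : ssub (val K)) : ssub (sub_tube_set K) :=
  exist _ (exist _ (val v) (sub_tube_in KG v)) (sub_tube_mem KG v).

Lemma sub_tube_fun_inj (K : nttube Γ) (KG : val K \subset val G) :
  injective (sub_tube_fun KG).
Proof. by move=> x y /(congr1 (fun z => val (val z)))/= /val_inj. Qed.

Lemma sub_tube_fun_surj (K : nttube Γ) (KG : val K \subset val G)
  (w : ssub (sub_tube_set K)) : exists v, sub_tube_fun KG v = w.
Proof.
have wK : val (val w) \in val K by have := valP w; rewrite inE.
by exists (exist _ (val (val w)) wK); do 2!apply: val_inj => /=.
Qed.

Lemma sub_tubeP (K : nttube Γ) (KG : val K \subset val G) :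
  is_tube (sub_tube_set K) && (1 < #|sub_tube_set K|)%N.
Proof.
have /andP[/andP[_ cK] K1] := valP K.
have K1' : (1 < #|sub_tube_set K|)%N.
  apply: leq_trans K1 _; rewrite -card_sig -(card_sig (mem (sub_tube_set K))).
  exact: leq_card _ (@sub_tube_fun_inj K KG).
rewrite K1' andbT /is_tube (ltnW K1') /=.
apply: (is_connected_surj (@sub_tube_fun_surj K KG) _ cK).
by move=> x y xy; right.
Qed.

(* A tube [K] of [Γ] contained in [G], seen as a tube of [Γ|_G] *)
Definition sub_tube (K : nttube Γ) (KG : val K \subset val G) :
  nttube (induced_graph G) := exist _ (sub_tube_set K) (sub_tubeP KG).

End tubes_of_contraction.

Lemma nttube_has_edge (Γ : graph) (K : nttube Γ) :
  exists x y : ssub (val K), edge (val x) (val y).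
Proof.
have /andP[/andP[_ cK] /card_gt1P[v [w [vK wK vw]]]] := valP K.
have /forallP/(_ (exist _ v vK))/forallP/(_ (exist _ w wK)) := cK.
move=> /connectP[[|z p]]; first by move=> _ [wv]; rewrite wv eqxx in vw.
by move=> /= /andP[vz _] _; exists (exist _ v vK), z.
Qed.

From mathcomp Require Import all_classical all_reals all_analysis.
Import numFieldNormedType.Exports.
Import Order.TTheory GRing.Theory Num.Theory.
Local Open Scope classical_set_scope.
Local Open Scope ring_scope.
Local Open Scope quotient_scope.

Record gcoll := GColl {
  gsp :> graph -> topologicalType;
  gmap : forall Γ Δ : graph, giso Γ Δ -> gsp Δ -> gsp Γ;
  gmap_continuous : forall (Γ Δ : graph) (f : giso Γ Δ), continuous (gmap f);
  gmap_id : forall (Γ : graph) (x : gsp Γ), gmap (giso_id Γ) x = x;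
  gmap_comp : forall (Γ Δ Λ : graph) (g : giso Δ Λ) (f : giso Γ Δ) (x : gsp Λ),
    gmap (giso_comp g f) x = gmap f (gmap g x) }.

(* The factor [∏_{G ∈ I} P(Γ|_G)] of the summand of [(M ∘ P)(Γ)] at [I]. *)
Definition blocks_prod (P : gcoll) (Γ : graph) (I : tpart Γ) :=
  prod_topology (fun G : block I => P (induced_graph (block_tube G))).

(* A family of maps [(M ∘ P)(Γ) -> M(Γ)], given on the summands. *)
Definition action (M P : gcoll) :=
  forall (Γ : graph) (I : tpart Γ), M (quot_graph I) -> blocks_prod P I -> M Γ.

Section action_axioms.
Variables (M P : gcoll) (μ : action M P).

Definition action_continuous := forall (Γ : graph) (I : tpart Γ),
  continuous (fun z : M (quot_graph I) * blocks_prod P I => μ z.1 z.2).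

Definition action_equivariant :=
  forall (Γ Δ : graph) (f : giso Γ Δ) (I : tpart Δ)
         (a : M (quot_graph I)) (b : blocks_prod P I),
    gmap f (μ a b) =
    μ (gmap (ppull_iso f I) a)
      (fun H : block (ppull f I) => gmap (ppull_induced_iso H) (b (ppull_iso f I H))).

(* Equality of the two maps [(M ∘ P) ∘ P -> M]. *)
Definition action_associative (γ : action P P) :=
  forall (Γ : graph) (I : tpart Γ) (J : tpart (quot_graph I))
         (a : M (quot_graph J)) (b : blocks_prod P J) (c : blocks_prod P I),
    μ (μ a b) c =
    μ (gmap (prefine_iso J) a)
      (fun H : block (prefine J) =>
         γ _ (prestr H) (gmap (prestr_iso H) (b (prefine_iso J H)))
           (fun K : block (prestr H) =>
              gmap (prestr_induced_iso K) (c (val (prestr_iso H K))))).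

Definition action_unital (u : P graph1) := forall (Γ : graph) (a : M Γ),
  μ (gmap (pdisc_iso Γ) a)
    (fun G : block (pdisc Γ) => gmap (iso1 (pdisc_card G)) u) = a.

End action_axioms.

Record contractad (P : gcoll) := Contractad {
  cunit : P graph1;
  cmul : action P P;
  cmul_continuous : action_continuous cmul;
  cmul_equivariant : action_equivariant cmul;
  cmul_associative : action_associative cmul cmul;
  cmul_unitr : action_unital cmul cunit;
  cmul_unitl : forall (Γ : graph) (b : P Γ),
    cmul (gmap (ptop_iso Γ) cunit)
      (fun G : block (ptop Γ) => gmap (ptop_induced_iso G) b) = b }.

Record right_module (P : gcoll) (C : contractad P) (M : gcoll) := RightModule {
  ract : action M P;
  ract_continuous : action_continuous ract;
  ract_equivariant : action_equivariant ract;
  ract_associative : action_associative ract (cmul C);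
  ract_unital : action_unital ract (cunit C) }.

Section partial_composition.
Variables (M P : gcoll) (μ : action M P) (u : P graph1).

(* [b] at the block [G] of [psingle G], and units at all other blocks *)
Definition units_except (Γ : graph) (G : tube Γ) (b : P (induced_graph G)) :
    blocks_prod P (psingle G) := fun H =>
  match boolP (val H == val G) with
  | AltTrue HG => gmap (induced_eq_giso (A := block_tube H) (B := G) (eqP HG)) b
  | AltFalse HG => gmap (iso1 (psingle_card HG)) u
  end.

(* [∘^Γ_G : M(Γ/G) × P(Γ|_G) -> M(Γ)] *)
Definition partial_comp (Γ : graph) (G : tube Γ)
    (a : M (quot_graph (psingle G))) (b : P (induced_graph G)) : M Γ :=
  μ a (units_except b).

End partial_composition.

Definition nonconstant (S : finType) (T : Type) : set {ptws S -> T} :=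
  [set x | exists s t, x s <> x t].

Section sphere.
Variables (R : realType) (E : lmodType R) (S : finType).

(* Representatives of nonzero vectors of [E^S / E] *)
Definition ncfg : Type := set_type (@nonconstant S E).
HB.instance Definition _ := Choice.on ncfg.

Definition mk_ncfg (x : S -> E) (h : nonconstant x) : ncfg := SigSub (mem_set h).

Lemma ncfgP (x : ncfg) : nonconstant (val x).
Proof. exact: set_mem (valP x). Qed.

Definition ray_rel (x y : ncfg) : bool :=
  `[< exists2 l : R, 0 < l & exists t : E, forall s, val y s = l *: val x s + t >].

Lemma ray_equiv : equiv_class_of ray_rel.
Proof.
split.
- by move=> x; apply/asboolP; exists 1 => //; exists 0 => s; rewrite scale1r addr0.
- apply: symmetric_from_pre => x y /asboolP[l l0 [t xy]]; apply/asboolP.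
  exists l^-1; first by rewrite invr_gt0.
  exists (- (l^-1 *: t)) => s; rewrite xy scalerDr scalerA mulVf ?gt_eqF//.
  by rewrite scale1r addrK.
- move=> y x z /asboolP[l l0 [t xy]] /asboolP[k k0 [u yz]]; apply/asboolP.
  exists (k * l); first exact: mulr_gt0.
  by exists (k *: t + u) => s; rewrite yz xy scalerDr scalerA addrA.
Qed.

Canonical ray_equivRel := EquivRelPack ray_equiv.

(* [(W ∖ 0) / R_{>0}] for [W = E^S / E] *)
Definition sph_quot := {eq_quot ray_rel}.

End sphere.

(* [sph 'rV[R]_d S] is S(W^d_S) with its quotient topology; for a tangent space
   [E], which carries no topology here, [sph E S] is only used as a set. *)
Definition sph (R : realType) (E : lmodType R) (S : finType) : Type :=
  quotient_topology (sph_quot E S).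

Section sphere_maps.
Variable R : realType.

Definition sph_class (E : lmodType R) (S : finType) (x : ncfg E S) : sph E S :=
  \pi_(sph_quot E S) x.

Lemma sph_classP (E : lmodType R) (S : finType) (x y : ncfg E S) :
  sph_class x = sph_class y <-> ray_rel x y.
Proof. by split=> [/eqmodP|xy]; [|apply/eqmodP]. Qed.

Lemma sph_class_surj (E : lmodType R) (S : finType) (w : sph E S) :
  exists x : ncfg E S, sph_class x = w.
Proof. by exists (repr (w : sph_quot E S)); exact: reprK. Qed.

Definition sph_repr (E : lmodType R) (S : finType) (w : sph E S) : ncfg E S :=
  repr (w : sph_quot E S).

Lemma sph_reprK (E : lmodType R) (S : finType) (w : sph E S) :
  sph_class (sph_repr w) = w.
Proof. exact: reprK. Qed.

Definition represents (E : lmodType R) (S : finType) (w : sph E S) (x : S -> E) :=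
  exists x' : ncfg E S, val x' = x /\ sph_class x' = w.

Section pullback.
Variables (E : lmodType R) (S T : finType) (p : S -> T).
Hypothesis p_surj : forall t, exists s, p s = t.

Lemma nonconstant_comp (X : Type) (x : T -> X) :
  nonconstant x -> @nonconstant S X (x \o p).
Proof.
by move=> [t [u tu]]; have [s sE] := p_surj t; have [r rE] := p_surj u;
  exists s, r => /=; rewrite sE rE.
Qed.

Definition ncfg_pull (x : ncfg E T) : ncfg E S :=
  mk_ncfg (nonconstant_comp (ncfgP x)).

(* [S(j)] for the map [j : E^T/E -> E^S/E] induced by [x |-> x \o p] *)
Definition sph_pull (w : sph E T) : sph E S := sph_class (ncfg_pull (sph_repr w)).

Lemma sph_pullE (x : ncfg E T) : sph_pull (sph_class x) = sph_class (ncfg_pull x).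
Proof.
apply/sph_classP; have /sph_classP/asboolP[l l0 [t h]] := sph_reprK (sph_class x).
by apply/asboolP; exists l => //; exists t => s; rewrite /= h.
Qed.

End pullback.

Section pushforward.
Variables (E F : lmodType R) (S : finType) (f : {linear E -> F}).
Hypothesis f_inj : injective f.

Lemma ncfg_push_subproof (x : ncfg E S) : @nonconstant S F (f \o val x).
Proof. by have [s [t st]] := ncfgP x; exists s, t => /= /f_inj. Qed.

Definition ncfg_push (x : ncfg E S) : ncfg F S := mk_ncfg (ncfg_push_subproof x).

Definition sph_push (w : sph E S) : sph F S := sph_class (ncfg_push (sph_repr w)).

Lemma sph_pushE (x : ncfg E S) : sph_push (sph_class x) = sph_class (ncfg_push x).
Proof.
apply/sph_classP; have /sph_classP/asboolP[l l0 [t h]] := sph_reprK (sph_class x).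
by apply/asboolP; exists l => //; exists (f t) => s; rewrite /= h linearD linearZ.
Qed.

End pushforward.
End sphere_maps.

Lemma continuous_into_prod (X : topologicalType) (I : Type)
    (T : I -> topologicalType) (f : X -> prod_topology T) :
  (forall i, continuous (fun x => f x i)) -> continuous f.
Proof.
move=> h x; apply/cvg_sup => i.
exact: (@continuous_comp_initial _ X _ (fun g : prod_topology T => g i) f (h i)).
Qed.

Lemma continuous_into_sub (X Y : topologicalType) (A : set Y) (f : X -> set_type A) :
  continuous (fun x => set_val (f x)) -> continuous f.
Proof. exact: continuous_comp_initial. Qed.

Lemma set_val_continuous (Y : topologicalType) (A : set Y) :
  continuous (set_val : set_type A -> Y).
Proof. exact: initial_continuous. Qed.

Lemma continuous_into_pair (X Y Z : topologicalType) (f : X -> Y) (g : X -> Z) :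
  continuous f -> continuous g -> continuous (fun x => (f x, g x)).
Proof. by move=> cf cg x; exact: cvg_pair (cf x) (cg x). Qed.

Lemma continuous_on_fst (X Y Z : topologicalType) (f : X -> Z) :
  continuous f -> continuous (fun z : X * Y => f z.1).
Proof. move=> cf z; apply: (@cvg_comp _ _ _ fst f _ (nbhs z.1)); [exact: cvg_fst|exact: cf]. Qed.

Lemma continuous_on_snd (X Y Z : topologicalType) (f : Y -> Z) :
  continuous f -> continuous (fun z : X * Y => f z.2).
Proof. move=> cf z; apply: (@cvg_comp _ _ _ snd f _ (nbhs z.2)); [exact: cvg_snd|exact: cf]. Qed.

Lemma closure_image (X Y : topologicalType) (f : X -> Y) (A : set X) (B : set Y) :
  continuous f -> (forall x, A x -> B (f x)) ->
  forall x, closure A x -> closure B (f x).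
Proof.
by move=> cf AB x clA U /cf/clA[y [/AB ? ?]]; exists (f y).
Qed.

Lemma ptws_comp_continuous (S T : finType) (X : topologicalType) (p : S -> T) :
  continuous ((fun x => x \o p) : {ptws T -> X} -> {ptws S -> X}).
Proof. by apply: continuous_into_prod => s; exact: proj_continuous. Qed.

Lemma sph_pull_continuous (R : realType) (d : nat) (S T : finType) (p : S -> T)
    (p_surj : forall t, exists s, p s = t) :
  continuous (sph_pull p_surj : sph 'rV[R]_d T -> sph 'rV[R]_d S).
Proof.
apply/quotient_continuous.
rewrite (_ : _ \o _ = @sph_class R 'rV[R]_d S \o ncfg_pull p_surj); last first.
  by apply/funext => x; exact: sph_pullE.
move=> x; apply: continuous_comp; last exact: pi_continuous.
move: x; apply: continuous_into_sub => x.
have cp : continuous (fun y : {ptws T -> 'rV[R]_d} => y \o p : {ptws S -> 'rV[R]_d}).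
  exact: ptws_comp_continuous.
exact: (continuous_comp (@set_val_continuous _ _ x) (cp _)).
Qed.

Lemma sph_pull_comp (R : realType) (E : lmodType R) (S T U : finType)
    (p : S -> T) (q : T -> U) (r : S -> U) ps qs rs (w : sph E U) :
  (forall s, q (p s) = r s) ->
  @sph_pull R E S T p ps (@sph_pull R E T U q qs w) = @sph_pull R E S U r rs w.
Proof.
move=> pqr; have [x <-] := sph_class_surj w; rewrite !sph_pullE.
congr sph_class; apply: val_inj; apply/funext => s /=.
by rewrite -pqr.
Qed.

Lemma sph_pull_id (R : realType) (E : lmodType R) (S : finType) (p : S -> S) ps
    (w : sph E S) : (forall s, p s = s) -> @sph_pull R E S S p ps w = w.
Proof.
move=> p1; have [x <-] := sph_class_surj w; rewrite sph_pullE.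
congr sph_class; apply: val_inj; apply/funext => s /=.
by rewrite p1.
Qed.

Lemma sph_pull_eq (R : realType) (E : lmodType R) (Γ : graph) (S : finType)
    (θ : forall K : nttube Γ, sph E (ssub (val K))) (K K' : nttube Γ)
    (p : S -> ssub (val K)) (p' : S -> ssub (val K')) ps ps' :
  (forall s, val (p s) = val (p' s)) ->
  val K = val K' -> @sph_pull R E _ _ p ps (θ K) = @sph_pull R E _ _ p' ps' (θ K').
Proof.
move=> pp' /val_inj KK'; subst K'.
have pE : p = p' by apply/funext => s; apply: val_inj.
by subst p'; congr sph_pull; exact: Prop_irrelevance.
Qed.

Definition conf (Γ : graph) (X : Type) : set {ptws Γ -> X} :=
  [set x | forall v w, edge v w -> x v <> x w].

Lemma conf_nonconstant (Γ : graph) (X : Type) (x : {ptws Γ -> X}) (K : nttube Γ) :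
  conf x -> @nonconstant (ssub (val K)) X (x \o val).
Proof.
by move=> cx; have [s [t st]] := nttube_has_edge K; exists s, t; exact: cx.
Qed.

Lemma conf_giso (Γ Δ : graph) (X : Type) (f : giso Γ Δ) (x : {ptws Δ -> X}) :
  conf x -> @conf Γ X (x \o f).
Proof. by move=> cx v w vw; apply: cx; rewrite gfun_edge. Qed.

Section FMd.
Variables (R : realType) (d : nat).

Definition FMd_ambient (Γ : graph) :=
  prod_topology (fun K : nttube Γ => sph 'rV[R]_d (ssub (val K))).

Definition FMd_rho (Γ : graph) (x : set_type (@conf Γ 'rV[R]_d)) : FMd_ambient Γ :=
  fun K => sph_class (mk_ncfg (conf_nonconstant K (set_mem (valP x)))).

(* When [Γ] has one vertex, the ambient product is empty and this is a point. *)
Definition FMd_space (Γ : graph) : set (FMd_ambient Γ) := closure (range (@FMd_rho Γ)).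

Section functoriality.
Variables (Γ Δ : graph) (f : giso Γ Δ).

Definition FMd_ambient_map (θ : FMd_ambient Δ) : FMd_ambient Γ :=
  fun K => sph_pull (imfun_surj (f := f) (K := val K)) (θ (imtube f K)).

Lemma FMd_ambient_map_continuous : continuous FMd_ambient_map.
Proof.
apply: continuous_into_prod => K θ.
exact: (continuous_comp (@proj_continuous _ _ (imtube f K) θ)
  (@sph_pull_continuous _ _ _ _ _ (imfun_surj (f := f) (K := val K)) _)).
Qed.

Lemma FMd_map_subproof (θ : set_type (@FMd_space Δ)) :
  FMd_space (FMd_ambient_map (val θ)).
Proof.
apply: (closure_image FMd_ambient_map_continuous _ (set_mem (valP θ))).
move=> _ [x _ <-]; exists (SigSub (mem_set (@conf_giso _ _ _ f _ (set_mem (valP x))))) => //.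
apply: functional_extensionality_dep => K; rewrite /FMd_ambient_map sph_pullE.
by congr sph_class; exact: val_inj.
Qed.

Definition FMd_map (θ : set_type (@FMd_space Δ)) : set_type (@FMd_space Γ) :=
  SigSub (mem_set (@FMd_map_subproof θ)).

Lemma FMd_map_continuous : continuous FMd_map.
Proof.
apply: continuous_into_sub => θ.
exact: (continuous_comp (@set_val_continuous _ _ θ) (@FMd_ambient_map_continuous _)).
Qed.
End functoriality.

Lemma FMd_map_id (Γ : graph) (θ : set_type (@FMd_space Γ)) :
  FMd_map (giso_id Γ) θ = θ.
Proof.
apply: val_inj; apply: functional_extensionality_dep => K /=.
have ids (s : ssub (val K)) : exists r, id r = s by exists s.
rewrite -[RHS](sph_pull_id (p := id) ids)//.
by apply: (@sph_pull_eq _ _ _ _ (val θ) (imtube _ K) K) => //=; exact: imset_id.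
Qed.

Lemma FMd_map_comp (Γ Δ Λ : graph) (g : giso Δ Λ) (f : giso Γ Δ)
    (θ : set_type (@FMd_space Λ)) :
  FMd_map (giso_comp g f) θ = FMd_map f (FMd_map g θ).
Proof.
apply: val_inj; apply: functional_extensionality_dep => K /=.
rewrite /FMd_ambient_map; set K' := imtube f K.
have rs w : exists v, @imfun _ _ g (val K') (@imfun _ _ f (val K) v) = w.
  have [u <-] := imfun_surj w; have [v <-] := imfun_surj u; by exists v.
rewrite (sph_pull_comp (r := fun v => @imfun _ _ g (val K') (@imfun _ _ f (val K) v))
  _ _ rs)//.
by apply: (@sph_pull_eq _ _ _ _ (val θ) (imtube (giso_comp g f) K) (imtube g K')) => //=;
  rewrite imset_comp.
Qed.

Definition FMd : gcoll := @GColl (fun Γ => set_type (@FMd_space Γ) : topologicalType)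
  FMd_map FMd_map_continuous FMd_map_id FMd_map_comp.

Definition FMd_natural (C : contractad FMd) : Prop :=
  forall (Γ : graph) (G : tube Γ)
         (a : FMd (quot_graph (psingle G))) (b : FMd (induced_graph G)),
    let c : FMd Γ := partial_comp (cmul C) (cunit C) a b in
    (forall (K : nttube Γ) (KG : val K \subset val G),
       val c K = sph_pull (sub_tube_fun_surj KG) (val b (sub_tube KG))) /\
    (forall (K : nttube Γ) (KG : ~~ (val K \subset val G)),
       val c K = sph_pull (imfun_surj (f := cls (psingle G)) (K := val K))
                          (val a (quot_tube KG))).

End FMd.

Section smooth.
Variables (R : realType) (V W : normedModType R).

Fixpoint Ck (n : nat) (U : set V) (f : V -> W) : Prop :=
  if n is m.+1
  then (forall x, U x -> differentiable f x) /\ (forall v, Ck m U ('D_v f))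
  else forall x, U x -> {for x, continuous f}.

Definition smooth_on (U : set V) (f : V -> W) : Prop := forall n, Ck n U f.

End smooth.

Record chart (R : realType) (d : nat) (M : topologicalType) := Chart {
  cdom : set M;
  cmap : M -> 'rV[R]_d;
  cinv : 'rV[R]_d -> M;
  cdom_open : open cdom;
  cimage_open : open (cmap @` cdom);
  cmapK : forall p, cdom p -> cinv (cmap p) = p;
  cmap_continuous : {within cdom, continuous cmap};
  cinv_continuous : {within cmap @` cdom, continuous cinv} }.

Record manifold (R : realType) (d : nat) := Manifold {
  mf_space :> topologicalType;
  mf_hausdorff : hausdorff_space mf_space;
  mf_second_countable : @second_countable mf_space;
  mf_index : Type;
  mf_chart : mf_index -> chart R d mf_space;
  mf_cover : forall p, exists i, cdom (mf_chart i) p;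
  mf_transition : forall i j,
    smooth_on (cmap (mf_chart i) @` (cdom (mf_chart i) `&` cdom (mf_chart j)))
              (cmap (mf_chart j) \o cinv (mf_chart i)) }.

Section tangent.
Variables (R : realType) (d : nat) (M : manifold R d).

Local Notation ix := (@mf_index R d M).
Local Notation ch := (@mf_chart R d M).

Definition transition (i j : ix) : 'rV[R]_d -> 'rV[R]_d :=
  cmap (ch j) \o cinv (ch i).

(* A tangent vector at [p] is the family of its coordinates in the charts
   around [p] (set to 0 for the other charts). *)
Definition tangent_pred (p : M) : {pred ix -> 'rV[R]_d} := fun v =>
  `[< (forall i, ~ cdom (ch i) p -> v i = 0) /\
      (forall i j, cdom (ch i) p -> cdom (ch j) p ->
         v j = 'd (transition i j) (cmap (ch i) p) (v i)) >].

Lemma tangent_submod (p : M) : submod_closed (tangent_pred p).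
Proof.
split.
  apply/asboolP; split=> [//|i j _ _] /=.
  by rewrite linear0.
move=> k u v /asboolP[u0 uE] /asboolP[v0 vE]; apply/asboolP; split=> [i ip|i j ip jp].
  by rewrite !fctE u0// v0// scaler0 addr0.
by rewrite !fctE linearP -uE// -vE.
Qed.

HB.instance Definition _ (p : M) :=
  GRing.isSubmodClosed.Build R (ix -> 'rV[R]_d) (tangent_pred p) (tangent_submod p).

Record tangent (p : M) := Tangent {
  tvec : ix -> 'rV[R]_d;
  tvecP : tvec \in tangent_pred p }.

HB.instance Definition _ (p : M) := [isSub for @tvec p].
HB.instance Definition _ (p : M) := [Choice of tangent p by <:].
HB.instance Definition _ (p : M) :=
  [SubChoice_isSubLmodule of tangent p by <:].

End tangent.

(* An isomorphism of smooth vector bundles [M × R^d ≅ TM] *)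
Record trivialization (R : realType) (d : nat) (M : manifold R d) := Trivialization {
  triv :> forall p : M, {linear 'rV[R]_d -> tangent p};
  triv_bij : forall p, bijective (triv p);
  triv_smooth : forall (i : mf_index M) (v : 'rV[R]_d),
    smooth_on (cmap (mf_chart i) @` cdom (mf_chart i))
              (fun y => tvec (triv (cinv (mf_chart i) y) v) i) }.

Section blowup.
Variables (R : realType) (d : nat) (M : manifold R d) (S : finType).

(* The points of the blow-up of [M^S]: points of [M^S] off the small diagonal,
   and points of the sphere bundle of the normal bundle [TM^S / TM]. *)
Inductive blowup : Type :=
| BlOff of set_type (@nonconstant S M)
| BlExc (p : M) of sph (tangent p) S.

HB.instance Definition _ := gen_eqMixin blowup.
HB.instance Definition _ := gen_choiceMixin blowup.

(* In the chart [i], the blow-up is the subspace of pairs [(y, w)] of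
   [(R^d)^S × S(W^d_S)] such that either [y] is not constant and [w] is its
   class, or [y] is constant: [bl_chart i z y w] means that [z] lies over the
   domain of the chart and has image [(y, w)]. *)
Definition bl_chart (i : mf_index M) (z : blowup)
    (yw : {ptws S -> 'rV[R]_d} * sph 'rV[R]_d S) : Prop :=
  match z with
  | BlOff x =>
      [/\ forall s, cdom (mf_chart i) (val x s),
          forall s, yw.1 s = cmap (mf_chart i) (val x s)
        & represents yw.2 yw.1]
  | BlExc p u =>
      [/\ cdom (mf_chart i) p,
          forall s, yw.1 s = cmap (mf_chart i) p
        & exists v : S -> tangent p,
            represents u v /\ represents yw.2 (fun s => tvec (v s) i)]
  end.

Definition bl_open (A : set blowup) : Prop :=
  open [set x : set_type (@nonconstant S M) | A (BlOff x)] /\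
  forall i : mf_index M, exists2 V : set ({ptws S -> 'rV[R]_d} * sph 'rV[R]_d S),
    open V & forall z yw, bl_chart i z yw -> (A z <-> V yw).

Lemma bl_openT : bl_open [set: blowup].
Proof. by split; [exact: openT | move=> i; exists setT => //; exact: openT]. Qed.

Lemma bl_openI : setI_closed bl_open.
Proof.
move=> A B [A0 A1] [B0 B1]; split; first exact: openI A0 B0.
move=> i; have [V oV hV] := A1 i; have [V' oV' hV'] := B1 i.
exists (V `&` V'); first exact: openI.
by move=> z yw h; have := hV _ _ h; have := hV' _ _ h; rewrite /setI /=; tauto.
Qed.

Lemma bl_open_bigU (I : Type) (f : I -> set blowup) :
  (forall i, bl_open (f i)) -> bl_open (\bigcup_i f i).
Proof.
move=> fo; split.
  rewrite (_ : mkset _ = \bigcup_i [set x | f i (BlOff x)]).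
    by apply: bigcup_open => i _; case: (fo i).
  by rewrite eqEsubset; split=> x [k _ kx]; exists k.
move=> i.
have /choice [V hV] : forall k, exists V : set ({ptws S -> 'rV[R]_d} * sph 'rV[R]_d S),
    open V /\ forall z yw, bl_chart i z yw -> (f k z <-> V yw).
  by move=> k; have [_ /(_ i)[V oV h]] := fo k; exists V.
exists (\bigcup_k V k); first by apply: bigcup_open => k _; case: (hV k).
move=> z yw h; split=> -[k _ kz]; exists k => //;
  by have [_ /(_ _ _ h)] := hV k; tauto.
Qed.

HB.instance Definition _ :=
  isOpenTopological.Build blowup bl_openT bl_openI bl_open_bigU.

End blowup.
Arguments BlOff {R d M S}.
Arguments BlExc {R d M S}.

Section blowup_pull.
Variables (R : realType) (d : nat) (M : manifold R d) (S T : finType) (p : S -> T).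
Hypothesis p_surj : forall t, exists s, p s = t.

Definition bl_off_pull (x : set_type (@nonconstant T M)) : set_type (@nonconstant S M) :=
  SigSub (mem_set (nonconstant_comp p_surj (set_mem (valP x)))).

(* The inclusion induced by repeating coordinates along [p] *)
Definition bl_pull (z : blowup M T) : blowup M S :=
  match z with
  | BlOff x => BlOff (bl_off_pull x)
  | BlExc q u => BlExc q (sph_pull p_surj u)
  end.

Lemma represents_pull (E : lmodType R) (u : sph E T) (v : T -> E) :
  represents u v -> represents (sph_pull p_surj u) (v \o p).
Proof.
by move=> [x [<- <-]]; exists (ncfg_pull p_surj x); split=> //; rewrite sph_pullE.
Qed.

Lemma bl_chart_pull (i : mf_index M) (z : blowup M T) yw :
  bl_chart i z yw -> bl_chart i (bl_pull z) (yw.1 \o p, sph_pull p_surj yw.2).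
Proof.
case: z => [x|q u] /=.
  move=> [xd yx yw1]; split; [by move=> s; exact: xd|by move=> s; exact: yx|].
  exact: represents_pull.
move=> [qd yq [v [uv wv]]]; split; [by []|by move=> s; exact: yq|].
exists (v \o p); split; first exact: represents_pull.
exact: (represents_pull wv).
Qed.

Lemma bl_off_pull_continuous : continuous bl_off_pull.
Proof.
apply: continuous_into_sub => x.
have cp : continuous (fun y : {ptws T -> M} => y \o p : {ptws S -> M}).
  exact: ptws_comp_continuous.
exact: (continuous_comp (@set_val_continuous _ _ x) (cp _)).
Qed.

Lemma bl_pull_continuous : continuous bl_pull.
Proof.
apply/continuousP => A [A0 A1]; split.
  by move: (bl_off_pull_continuous) => /continuousP/(_ _ A0).
move=> i; have [V oV hV] := A1 i.
pose m (yw : {ptws T -> 'rV[R]_d} * sph 'rV[R]_d T) :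
  {ptws S -> 'rV[R]_d} * sph 'rV[R]_d S := (yw.1 \o p, sph_pull p_surj yw.2).
have cm : continuous m.
  apply: continuous_into_pair.
    exact: (continuous_on_fst (@ptws_comp_continuous S T 'rV[R]_d p)).
  exact: (continuous_on_snd (@sph_pull_continuous R d S T p p_surj)).
exists (m @^-1` V); first by move/continuousP : cm => /(_ _ oV).
by move=> z yw /bl_chart_pull/hV.
Qed.

End blowup_pull.

Lemma bl_pull_comp (R : realType) (d : nat) (M : manifold R d) (S T U : finType)
    (p : S -> T) (q : T -> U) (r : S -> U) ps qs rs (z : blowup M U) :
  (forall s, q (p s) = r s) ->
  @bl_pull R d M S T p ps (@bl_pull R d M T U q qs z) = @bl_pull R d M S U r rs z.
Proof.
move=> pqr; case: z => [x|m u] /=; last by congr BlExc; exact: sph_pull_comp.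
by congr BlOff; apply: val_inj; apply/funext => s /=; rewrite pqr.
Qed.

Lemma bl_pull_id (R : realType) (d : nat) (M : manifold R d) (S : finType)
    (p : S -> S) ps (z : blowup M S) :
  (forall s, p s = s) -> @bl_pull R d M S S p ps z = z.
Proof.
move=> p1; case: z => [x|m u] /=; last by congr BlExc; exact: sph_pull_id.
by congr BlOff; apply: val_inj; apply/funext => s /=; rewrite p1.
Qed.

Lemma bl_pull_eq (R : realType) (d : nat) (M : manifold R d) (Γ : graph) (S : finType)
    (θ : forall K : nttube Γ, blowup M (ssub (val K))) (K K' : nttube Γ)
    (p : S -> ssub (val K)) (p' : S -> ssub (val K')) ps ps' :
  (forall s, val (p s) = val (p' s)) ->
  val K = val K' -> @bl_pull R d M _ _ p ps (θ K) = @bl_pull R d M _ _ p' ps' (θ K').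
Proof.
move=> pp' /val_inj KK'; subst K'.
have pE : p = p' by apply/funext => s; apply: val_inj.
by subst p'; congr bl_pull; exact: Prop_irrelevance.
Qed.

Section FMM.
Variables (R : realType) (d : nat) (M : manifold R d).

Definition FMM_blowups (Γ : graph) :=
  prod_topology (fun K : nttube Γ => blowup M (ssub (val K))).

Definition FMM_ambient (Γ : graph) : Type := ({ptws Γ -> M} * FMM_blowups Γ)%type.

Definition FMM_rho (Γ : graph) (x : set_type (@conf Γ M)) : FMM_ambient Γ :=
  (val x, fun K => BlOff (SigSub (mem_set (conf_nonconstant K (set_mem (valP x)))))).

Definition FMM_space (Γ : graph) : set (FMM_ambient Γ) := closure (range (@FMM_rho Γ)).

Section functoriality.
Variables (Γ Δ : graph) (f : giso Γ Δ).

Definition FMM_ambient_map (θ : FMM_ambient Δ) : FMM_ambient Γ :=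
  (θ.1 \o f,
   fun K => bl_pull (imfun_surj (f := f) (K := val K)) (θ.2 (imtube f K))).

Lemma FMM_ambient_map_continuous : continuous FMM_ambient_map.
Proof.
apply: continuous_into_pair.
  exact: (continuous_on_fst (@ptws_comp_continuous Γ Δ M f)).
apply: continuous_into_prod => K.
apply: (continuous_on_snd (f := fun θ2 : FMM_blowups Δ =>
  bl_pull (imfun_surj (f := f) (K := val K)) (θ2 (imtube f K)))) => θ2.
exact: (continuous_comp (@proj_continuous _ _ (imtube f K) θ2)
  (@bl_pull_continuous _ _ _ _ _ _ (imfun_surj (f := f) (K := val K)) _)).
Qed.

Lemma FMM_map_subproof (θ : set_type (@FMM_space Δ)) :
  FMM_space (FMM_ambient_map (val θ)).
Proof.
apply: (closure_image FMM_ambient_map_continuous _ (set_mem (valP θ))).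
move=> _ [x _ <-].
exists (SigSub (mem_set (@conf_giso _ _ _ f _ (set_mem (valP x))))) => //.
congr pair; apply: functional_extensionality_dep => K /=.
by congr BlOff; exact: val_inj.
Qed.

Definition FMM_map (θ : set_type (@FMM_space Δ)) : set_type (@FMM_space Γ) :=
  SigSub (mem_set (@FMM_map_subproof θ)).

Lemma FMM_map_continuous : continuous FMM_map.
Proof.
apply: continuous_into_sub => θ.
exact: (continuous_comp (@set_val_continuous _ _ θ) (@FMM_ambient_map_continuous _)).
Qed.
End functoriality.

Lemma FMM_map_id (Γ : graph) (θ : set_type (@FMM_space Γ)) :
  FMM_map (giso_id Γ) θ = θ.
Proof.
apply: val_inj; rewrite [RHS]surjective_pairing; congr pair.
apply: functional_extensionality_dep => K /=.
have ids (s : ssub (val K)) : exists r, id r = s by exists s.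
rewrite -[RHS](bl_pull_id (p := id) ids)//.
by apply: (@bl_pull_eq _ _ _ _ _ (val θ).2 (imtube _ K) K) => //=; exact: imset_id.
Qed.

Lemma FMM_map_comp (Γ Δ Λ : graph) (g : giso Δ Λ) (f : giso Γ Δ)
    (θ : set_type (@FMM_space Λ)) :
  FMM_map (giso_comp g f) θ = FMM_map f (FMM_map g θ).
Proof.
apply: val_inj; congr pair; apply: functional_extensionality_dep => K /=.
set K' := imtube f K.
have rs w : exists v, @imfun _ _ g (val K') (@imfun _ _ f (val K) v) = w.
  have [u <-] := imfun_surj w; have [v <-] := imfun_surj u; by exists v.
rewrite (bl_pull_comp (r := fun v => @imfun _ _ g (val K') (@imfun _ _ f (val K) v))
  _ _ rs)//.
by apply: (@bl_pull_eq _ _ _ _ _ (val θ).2 (imtube (giso_comp g f) K) (imtube g K'))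
  => //=; rewrite imset_comp.
Qed.

Definition FMM : gcoll := @GColl (fun Γ => set_type (@FMM_space Γ) : topologicalType)
  FMM_map FMM_map_continuous FMM_map_id FMM_map_comp.

(* The action of [FM_d] on [FM_M] described by its components, for the
   identification of the exceptional divisors with [M × S(W^d_K)] by [τ]. *)
Definition FMM_natural (τ : trivialization M) (C : contractad (FMd R d))
    (A : right_module C FMM) : Prop :=
  forall (Γ : graph) (G : tube Γ)
         (a : FMM (quot_graph (psingle G))) (b : FMd R d (induced_graph G)),
    let c : FMM Γ := partial_comp (ract A) (cunit C) a b in
    [/\ forall v : Γ, (val c).1 v = (val a).1 (cls (psingle G) v),
        forall (K : nttube Γ) (KG : val K \subset val G),
          let p := (val a).1 (vertexG G) in
          (val c).2 K =
          BlExc p (sph_push (bij_inj (triv_bij τ p))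
                     (sph_pull (sub_tube_fun_surj KG) (val b (sub_tube KG))))
      & forall (K : nttube Γ) (KG : ~~ (val K \subset val G)),
          (val c).2 K =
          bl_pull (imfun_surj (f := cls (psingle G)) (K := val K))
                  ((val a).2 (quot_tube KG))].

End FMM.

(* Main.v *)
Require Import Defs.
From HB Require Import structures.
From mathcomp Require Import all_boot all_order all_algebra.
From mathcomp Require Import all_classical all_reals all_analysis.

Set Implicit Arguments.
Unset Strict Implicit.
Unset Printing Implicit Defensive.

Import Order.TTheory GRing.Theory Num.Theory numFieldNormedType.Exports.
Local Open Scope classical_set_scope.
Local Open Scope ring_scope.

(** Both structures are instances of one construction.  A point of FM_d(Γ), or of
    FM_M(Γ), is a family indexed by the nontrivial tubes K of Γ, whose entry at
    K lives in a space attached to the finite set K (a sphere, resp. a blow-up)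
    that pulls back along surjections.  Given a partition I into tubes, a family
    a on Γ/I and families b_G on the blocks G, the composite is at K the entry
    of b_G if K lies in some block G (seen in the exceptional divisor over the
    point of a at G), and otherwise the pullback of the entry of a at the image
    of K in Γ/I.  The entries of any two composites of the same data come from
    the same entry of the same family by pulling back along surjections that
    agree pointwise; so equivariance, associativity and unitality reduce to
    functoriality of pullback, case by case according to whether K lies in a
    block ([compose_equivariant], [compose_associative]).

    What needs geometry is that composites stay in the closures that define FM_d
    and FM_M.  Composition is continuous on the ambient products, so it is
    enough to compose images of genuine configurations ([closure_image_pair]).
    For these, replace each point x_G of the configuration on Γ/I by the
    cluster x_G + e y_G with e > 0 small; on a manifold this is done in a chart
    around x_G, the trivialization turning y_G into tangent vectors at x_G.
    For small e this is a configuration on Γ: points of one block differ since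
    those of y_G do, and adjacent points of distinct blocks tend to distinct
    limits.  As e tends to 0, the image of this configuration tends to the
    composite ([FMd_insertion], [FMM_insertion]): inside a block the direction
    is constantly that of y_G, and elsewhere the cluster collapses onto x.

    On a manifold, continuity of composition comes down to joint continuity of
    (p, u) |-> the point of the exceptional divisor over p in the direction u
    ([exc_point_continuous]).  In a chart this is the continuity of the
    trivialization together with the fact that passing from nonconstant
    configurations to their directions is an open map ([sph_class_open]), which
    makes its product with M a quotient map as well. *)

(** * Families indexed by tubes and their composition *)

(** The form in which [sph_pull] and [bl_pull] take surjectivity. *)
Notation onto p := (forall t, exists s, p s = t).

(** A contravariant functor from finite sets and surjections to spaces: what
    spheres of directions and spherical blow-ups have in common. *)
Record coeff := Coeff {
  csp :> finType -> topologicalType;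
  cpull : forall (S T : finType) (p : S -> T), onto p -> csp T -> csp S;
  cpull_continuous : forall (S T : finType) (p : S -> T) (ps : onto p),
    continuous (cpull ps);
  cpull_comp : forall (S T U : finType) (p : S -> T) (q : T -> U) (ps : onto p)
    (qs : onto q) (rs : onto (q \o p)) w, cpull ps (cpull qs w) = cpull rs w;
  cpull_id : forall (S : finType) (ids : onto (@id S)) w, cpull ids w = w }.

(** A family of maps X × F(S) -> B(S), natural in S.  For blow-ups, X is the
    manifold, F(S) the sphere of directions, B(S) the blow-up, and the map is
    the inclusion of the exceptional divisor. *)
Record exceptional (X : topologicalType) (F B : coeff) := Exceptional {
  exc : forall S : finType, X -> F S -> B S;
  exc_pull : forall (S T : finType) (p : S -> T) (ps : onto p) x u,
    cpull ps (exc x u) = exc x (cpull ps u);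
  exc_continuous : forall S : finType,
    continuous (fun z : X * F S => exc z.1 z.2) }.

Definition tube_prod (B : coeff) (Γ : graph) :=
  prod_topology (fun K : nttube Γ => B (ssub (val K))).

Lemma onto_comp (S T U : Type) (p : S -> T) (q : T -> U) :
  onto p -> onto q -> onto (q \o p).
Proof. by move=> ps qs u; have [t <-] := qs u; have [s <-] := ps t; exists s. Qed.

Section pull_theory.
Variable B : coeff.

(** The tubes [K] and [K'] are only propositionally equal (each is the image of
    the surjection into it), so the two sides cannot be compared by rewriting.
    Every identity between composites ends with this lemma. *)
Lemma cpull_eq (Γ : graph) (S : finType) (θ : tube_prod B Γ) (K K' : nttube Γ)
    (p : S -> ssub (val K)) (p' : S -> ssub (val K')) (ps : onto p) (ps' : onto p') :
  (forall s, val (p s) = val (p' s)) -> cpull ps (θ K) = cpull ps' (θ K').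
Proof.
move=> pp'; have KK' : val K = val K'.
  apply/setP => v; apply/idP/idP => vK.
    by have [s sE] := ps (exist _ v vK); have := valP (p' s); rewrite -pp' sE.
  by have [s sE] := ps' (exist _ v vK); have := valP (p s); rewrite pp' sE.
move/val_inj : KK' => KK'; subst K'.
have pE : p = p' by apply/funext => s; apply: val_inj.
by subst p'; congr cpull; exact: Prop_irrelevance.
Qed.

Lemma cpull_fix (Γ : graph) (θ : tube_prod B Γ) (K L : nttube Γ)
    (p : ssub (val K) -> ssub (val L)) (ps : onto p) :
  (forall s, val (p s) = val s) -> cpull ps (θ L) = θ K.
Proof.
move=> pE; have ids : onto (@id (ssub (val K))) by move=> s; exists s.
by rewrite -[RHS](cpull_id ids); exact: cpull_eq.
Qed.

Definition relabel (Γ Δ : graph) (f : giso Γ Δ) (θ : tube_prod B Δ) : tube_prod B Γ :=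
  fun K => cpull (imfun_surj (f := f) (K := val K)) (θ (imtube f K)).

End pull_theory.

(* Unification cannot recover a tube from the finite set underlying it, so the
   family and the tubes are read off the goal. *)
Ltac same_pull :=
  match goal with |- @eq _ (cpull _ (?a ?K)) (cpull _ (?a ?K')) =>
    apply: (@cpull_eq _ _ _ a K K')
  | |- @eq _ (cpull _ (?a ?L)) (?a ?K) => apply: (@cpull_fix _ _ a K L)
  end.

Section tubes_and_partitions.
Variables (Γ : graph) (I : tpart Γ).

Definition in_block (K : nttube Γ) := [exists G : block I, val K \subset val G].

Lemma block_unique (K : nttube Γ) (G H : block I) :
  val K \subset val G -> val K \subset val H -> G = H.
Proof.
have /andP[/andP[/card_gt0P[v vK] _] _] := valP K.
move=> /fintype.subsetP/(_ v vK)/cls_eqP <- /fintype.subsetP/(_ v vK)/cls_eqP <-.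
by [].
Qed.

Lemma contracted_proof (K : nttube Γ) : ~~ in_block K ->
  @is_tube (quot_graph I) (cls I @: val K) && (1 < #|cls I @: val K|)%N.
Proof.
move=> /existsPn KI; have /andP[tK cK] := valP K.
have tI : @is_tube (quot_graph I) (cls I @: val K).
  by apply: is_tube_image tK => x y; exact: (@cls_edge _ I).
rewrite tI /=.
(* A vertex of [K] outside the block of another one has a different image. *)
have /card_gt0P[v vK] := ltnW cK.
have /subsetPn[w wK wG] := KI (cls I v).
have: [set cls I v; cls I w]%SET \subset cls I @: val K.
  by apply/fintype.subsetP => z /finset.set2P[] ->; exact: imset_f.
move=> /subset_leq_card; apply: leq_trans; rewrite finset.cards2.
suff -> : cls I v != cls I w by [].
by apply: contra wG => /eqP ->; exact: mem_cls.
Qed.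

Definition contracted (K : nttube Γ) (KI : ~~ in_block K) : nttube (quot_graph I) :=
  exist _ (cls I @: val K) (contracted_proof KI).

End tubes_and_partitions.

Section composition.
Variables (X : topologicalType) (F B : coeff) (ε : exceptional X F B).

Definition blocks_tube_prod (Γ : graph) (I : tpart Γ) :=
  prod_topology (fun G : block I => tube_prod F (induced_graph (block_tube G))).

Section one_partition.
Variables (Γ : graph) (I : tpart Γ).

(** The composite of a family on the quotient with families on the blocks; [x]
    gives the points over which the blocks are inserted.  The block containing
    a tube is unique when it exists, but has to be chosen here. *)
Definition compose (x : quot_graph I -> X) (a : tube_prod B (quot_graph I))
    (b : blocks_tube_prod I) : tube_prod B Γ := fun K =>
  match pselect (exists G : block I, val K \subset val (block_tube G)) with
  | left KI =>
      let: exist G KG := cid KI in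
      exc ε (x G) (cpull (sub_tube_fun_surj KG) (b G (sub_tube KG)))
  | right KI =>
      cpull (imfun_surj (f := cls I) (K := val K))
        (a (contracted (introN existsP KI : ~~ in_block I K)))
  end.

Lemma compose_in (x : quot_graph I -> X) (a : tube_prod B (quot_graph I))
    (b : blocks_tube_prod I) (K : nttube Γ) (G : block I)
    (KG : val K \subset val (block_tube G)) :
  compose x a b K = exc ε (x G) (cpull (sub_tube_fun_surj KG) (b G (sub_tube KG))).
Proof.
rewrite /compose; case: pselect => [KI|[]]; last by exists G.
case: cid => H KH; have HG := block_unique KH KG; subst H.
by have -> : KH = KG by exact: bool_irrelevance.
Qed.

Lemma compose_out (x : quot_graph I -> X) (a : tube_prod B (quot_graph I))
    (b : blocks_tube_prod I) (K : nttube Γ) (KI : ~~ in_block I K) :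
  compose x a b K =
  cpull (imfun_surj (f := cls I) (K := val K)) (a (contracted KI)).
Proof.
rewrite /compose; case: pselect => [KI'|KI']; first by case/negP: (KI); exact/existsP.
by same_pull.
Qed.

End one_partition.
End composition.

Lemma cpull2 (B : coeff) (S T U : finType) (p : S -> T) (q : T -> U)
  (ps : onto p) (qs : onto q) (w : B U) :
  cpull ps (cpull qs w) = cpull (onto_comp ps qs) w.
Proof. exact: cpull_comp. Qed.

Lemma trivial_exc_continuous (X : topologicalType) (F : coeff) (S : finType) :
  continuous (fun z : X * F S => z.2).
Proof. exact: (continuous_on_snd (fun u => @cvg_id _ (nbhs u))). Qed.

(** The case of spheres themselves: directions inside a block are kept as they
    are. *)
Definition trivial_exc (X : topologicalType) (F : coeff) : exceptional X F F :=
  @Exceptional X F F (fun _ _ u => u) (fun _ _ _ _ _ _ => erefl)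
    (@trivial_exc_continuous X F).

Lemma trivial_excE (X : topologicalType) (F : coeff) (S : finType) (x : X) (u : F S) :
  exc (trivial_exc X F) x u = u.
Proof. by []. Qed.

Lemma ppull_isoE (Γ Δ : graph) (f : giso Γ Δ) (I : tpart Δ) (v : Γ) :
  ppull_iso f I (cls (ppull f I) v) = cls I (f v).
Proof. by rewrite /ppull_iso quot_isoE. Qed.

Lemma prefine_isoE (Γ : graph) (I : tpart Γ) (J : tpart (quot_graph I)) (v : Γ) :
  prefine_iso J (cls (prefine J) v) = cls J (cls I v).
Proof. by rewrite /prefine_iso quot_isoE. Qed.

Lemma pdisc_isoE (Γ : graph) (v : Γ) : pdisc_iso Γ (cls (pdisc Γ) v) = v.
Proof. by rewrite /pdisc_iso quot_isoE. Qed.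

Lemma prestr_isoE (Γ : graph) (I : tpart Γ) (J : tpart (quot_graph I))
    (H : block (prefine J)) (v : induced_graph (block_tube H)) :
  val (prestr_iso H (cls (prestr H) v)) = cls I (val v).
Proof. by rewrite /prestr_iso quot_isoE. Qed.

(** * Equivariance, associativity and unit laws *)

Section laws.
Variables (X : topologicalType) (F B : coeff) (ε : exceptional X F B).

Lemma compose_equivariant (Γ Δ : graph) (f : giso Γ Δ) (I : tpart Δ)
    (x : quot_graph I -> X) (a : tube_prod B (quot_graph I)) (b : blocks_tube_prod F I) :
  relabel f (compose ε x a b) =
  compose ε (x \o ppull_iso f I) (relabel (ppull_iso f I) a)
    (fun H : block (ppull f I) =>
       relabel (ppull_induced_iso H) (b (ppull_iso f I H))).
Proof.
apply: functional_extensionality_dep => K; rewrite /relabel.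
have [/existsP[H KH]|KI] := boolP (in_block (ppull f I) K).
  have KG : val (imtube f K) \subset val (block_tube (ppull_iso f I H)).
    apply/fintype.subsetP => _ /imsetP[v vK ->] /=.
    by rewrite -ppull_mem; exact: (fintype.subsetP KH).
  rewrite (compose_in _ _ _ _ KG) (@compose_in _ _ _ _ _ _ _ _ _ _ H KH).
  rewrite exc_pull !cpull2; congr (exc ε _ _).
  by same_pull => s; exact: val_inj.
have fKI : ~~ in_block I (imtube f K).
  apply/existsPn => G; apply: contra KI => KG.
  have [v vG] := ppull_surj f G.
  apply/existsP; exists (cls (ppull f I) v).
  apply/fintype.subsetP => w wK.
  rewrite ppull_mem quot_isoE vG.
  by apply: (fintype.subsetP KG); exact: imset_f.
rewrite (compose_out _ _ _ _ fKI) (compose_out _ _ _ _ KI) !cpull2.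
by same_pull => s; apply: esym; exact: quot_isoE.
Qed.

(** There are three cases for a tube: it lies in a block G of I, and both sides
    are the entry of [c] at G; or only its image in Γ/I lies in a block B of J,
    and both sides are the entry of [b] at B; or neither, and both sides are
    entries of [a]. *)
Lemma compose_associative (Γ : graph) (I : tpart Γ) (J : tpart (quot_graph I))
    (Y : topologicalType) (y0 : Y)
    (x : quot_graph J -> X) (a : tube_prod B (quot_graph J)) (b : blocks_tube_prod F J)
    (c : blocks_tube_prod F I) :
  compose ε (x \o cls J) (compose ε x a b) c =
  compose ε (x \o prefine_iso J) (relabel (prefine_iso J) a)
    (fun H : block (prefine J) =>
       compose (trivial_exc Y F) (fun=> y0) (relabel (prestr_iso H) (b (prefine_iso J H)))
         (fun K : block (prestr H) =>
            relabel (prestr_induced_iso K) (c (val (prestr_iso H K))))).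
Proof.
apply: functional_extensionality_dep => K.
have [/existsP[G KG]|KI] := boolP (in_block I K).
  have [v vK] : exists v, v \in val K.
    by have /andP[/andP[/card_gt0P[v vK] _] _] := valP K; exists v.
  have vG := fintype.subsetP KG _ vK.
  have /cls_eqP vGE := vG.
  (* [H] and [K'] are the blocks of the refined partitions with K ⊂ K' ⊂ H. *)
  pose H := cls (prefine J) v.
  have HE : prefine_iso J H = cls J G by rewrite quot_isoE vGE.
  have KH : val K \subset val (block_tube H).
    apply/fintype.subsetP => w wK; rewrite prefine_mem HE.
    have /cls_eqP -> := fintype.subsetP KG _ wK; exact: mem_cls.
  pose v' : induced_graph (block_tube H) :=
    exist _ v (fintype.subsetP KH _ vK).
  pose K' := cls (prestr H) v'.
  have K'E : val (prestr_iso H K') = G by exact (etrans (prestr_isoE v') vGE).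
  have KK' : val (sub_tube KH) \subset val (block_tube K').
    apply/fintype.subsetP => w; rewrite inE => wK.
    rewrite prestr_mem; move: (val (prestr_iso H K')) K'E => _ ->.
    exact: (fintype.subsetP KG).
  rewrite (@compose_in _ _ _ _ _ _ _ _ _ _ H KH) (compose_in _ _ _ _ KK') trivial_excE.
  have KG' : val K \subset val (block_tube (val (prestr_iso H K'))).
    by move: (val (prestr_iso H K')) K'E => _ ->.
  rewrite (@compose_in _ _ _ _ _ _ _ _ _ _ _ KG') /relabel !cpull2.
  congr (exc ε (x _) _); first exact: etrans (congr1 (cls J) K'E) (esym HE).
  by same_pull => s; exact: val_inj.
rewrite (compose_out _ _ _ _ KI).
have [/existsP[B0 KB]|KJ] := boolP (in_block J (contracted KI)).
  have [G GB] := prefine_surj B0.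
  pose H := cls (prefine J) G.
  have HE : prefine_iso J H = B0 by rewrite quot_isoE.
  move: B0 HE KB {GB} => _ <- KB.
  have KH : val K \subset val (block_tube H).
    apply/fintype.subsetP => w wK; rewrite prefine_mem.
    by apply: (fintype.subsetP KB); exact: imset_f.
  rewrite (@compose_in _ _ _ _ _ _ _ _ _ _ _ KB) (@compose_in _ _ _ _ _ _ _ _ _ _ H KH).
  have nK : ~~ in_block (prestr H) (sub_tube KH).
    apply: contra (KI) => /existsP[K' KK'].
    apply/existsP; exists (val (prestr_iso H K')).
    apply/fintype.subsetP => w wK.
    have wH := fintype.subsetP KH _ wK.
    have := fintype.subsetP KK' (exist _ w wH).
    by rewrite inE prestr_mem; exact.
  rewrite (compose_out _ _ _ _ nK) exc_pull /relabel !cpull2; congr (exc ε _ _).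
  by same_pull => s; apply: val_inj; apply: esym; exact: prestr_isoE.
have KIJ : ~~ in_block (prefine J) K.
  apply: contra (KJ) => /existsP[H KH].
  apply/existsP; exists (prefine_iso J H).
  apply/fintype.subsetP => _ /imsetP[w wK ->].
  by rewrite -prefine_mem; exact: (fintype.subsetP KH).
rewrite (compose_out _ _ _ _ KJ) (compose_out _ _ _ _ KIJ) /relabel !cpull2.
by same_pull => s; apply: esym; exact: quot_isoE.
Qed.

(** No tube with two vertices lies in a block of the discrete partition. *)
Lemma compose_unitr (Γ : graph) (x : quot_graph (pdisc Γ) -> X) (a : tube_prod B Γ)
    (b : blocks_tube_prod F (pdisc Γ)) :
  compose ε x (relabel (pdisc_iso Γ) a) b = a.
Proof.
apply: functional_extensionality_dep => K.
have KI : ~~ in_block (pdisc Γ) K.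
  apply/existsPn => G; apply/negP => /subset_leq_card.
  have /andP[_ K1] := valP K.
  by rewrite -(card_sig (mem (val G))) (pdisc_card G) leqNgt K1.
rewrite (compose_out _ _ _ _ KI) /relabel cpull2.
by same_pull => s; exact: quot_isoE.
Qed.

(** Every tube lies in the unique block of the trivial partition. *)
Lemma compose_unitl (Γ : graph) x a (b : tube_prod F Γ) (K : nttube Γ) :
  compose ε x a (fun G : block (ptop Γ) => relabel (ptop_induced_iso G) b) K =
  exc ε (x (cls (ptop Γ) (xchoose (card_gt0P (vertex_nonempty Γ))))) (b K).
Proof.
set G := cls _ _.
have KG : val K \subset val (block_tube G).
  by apply/fintype.subsetP => w _; exact: ptop_blockE.
rewrite (@compose_in _ _ _ _ _ _ _ _ _ _ _ KG) /relabel cpull2; congr (exc ε _ _).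
by same_pull.
Qed.

Section single.
Variables (Γ : graph) (G : tube Γ).

(** As a vertex set the nontrivial block is G, but its induced graph is G only up
    to an isomorphism, so the family inserted there is given up to relabelling. *)
Lemma compose_single_in (x : quot_graph (psingle G) -> X)
    (a : tube_prod B (quot_graph (psingle G))) (b : blocks_tube_prod F (psingle G))
    (b0 : tube_prod F (induced_graph G)) (K : nttube Γ)
    (KG : val K \subset val G) :
  (forall (H : block (psingle G)) (HG : val H = val G),
     b H = relabel (induced_eq_giso (A := block_tube H) (B := G) HG) b0) ->
  compose ε x a b K =
  exc ε (x (vertexG G)) (cpull (sub_tube_fun_surj KG) (b0 (sub_tube KG))).
Proof.
move=> /(_ (vertexG G) erefl) bE.
rewrite (@compose_in _ _ _ _ _ _ _ _ _ _ (vertexG G) KG) bE /relabel cpull2.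
by congr (exc ε _ _); same_pull => s; apply: val_inj.
Qed.

Lemma compose_single_out (x : quot_graph (psingle G) -> X)
    (a : tube_prod B (quot_graph (psingle G))) (b : blocks_tube_prod F (psingle G))
    (K : nttube Γ) (KG : ~~ (val K \subset val G)) :
  compose ε x a b K =
  cpull (imfun_surj (f := cls (psingle G)) (K := val K)) (a (quot_tube KG)).
Proof.
have KI : ~~ in_block (psingle G) K.
  apply/existsPn => H; have [->//|HG] := eqVneq (val H) (val G).
  apply/negP => /subset_leq_card; have /andP[_ K1] := valP K.
  by rewrite -(card_sig (mem (val H))) (psingle_card HG) leqNgt K1.
by rewrite (compose_out _ _ _ _ KI); same_pull.
Qed.
End single.
End laws.

(** * Continuity of composition and closures *)

Section compose_continuity.
Variables (X : topologicalType) (F B : coeff) (ε : exceptional X F B).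
Variables (Γ : graph) (I : tpart Γ).

Let Z := ({ptws quot_graph I -> X} * tube_prod B (quot_graph I) *
          blocks_tube_prod F I)%type.

Lemma compose_jointly_continuous : continuous (fun z : Z => compose ε z.1.1 z.1.2 z.2).
Proof.
apply: continuous_into_prod => K.
have [/existsP[G KG]|KI] := boolP (in_block I K).
  rewrite (_ : (fun z => _) = (fun xu => exc ε xu.1 xu.2) \o (fun z : Z =>
      (z.1.1 G, cpull (sub_tube_fun_surj (G := block_tube G) KG)
                  (z.2 G (sub_tube (G := block_tube G) KG))))); last first.
    apply: funext => z /=; exact: (@compose_in _ _ _ _ _ _ _ _ _ K G KG).
  move=> z; apply: continuous_comp; last exact: exc_continuous.
  move: z; apply: continuous_into_pair.
    apply: (continuous_on_fst (f := fun xa : {ptws quot_graph I -> X} *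
      tube_prod B (quot_graph I) => xa.1 G)).
    apply: (continuous_on_fst (f := fun x : {ptws quot_graph I -> X} => x G)).
    exact: proj_continuous.
  apply: (continuous_on_snd (f := fun b : blocks_tube_prod F I =>
    cpull (sub_tube_fun_surj (G := block_tube G) KG)
                  (b G (sub_tube (G := block_tube G) KG)))) => b.
  apply: (@continuous_comp _ _ _ (fun b : blocks_tube_prod F I =>
    b G (sub_tube (G := block_tube G) KG))); last exact: cpull_continuous.
  apply: (@continuous_comp _ _ _ (fun b : blocks_tube_prod F I => b G)
    (fun u : tube_prod F (induced_graph (block_tube G)) =>
       u (sub_tube (G := block_tube G) KG))); exact: proj_continuous.
rewrite (_ : (fun z => _) = (fun z : Z =>
    cpull (imfun_surj (f := cls I) (K := val K)) (z.1.2 (contracted KI)))); last first.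
  by apply: funext => z /=; exact: compose_out.
apply: (continuous_on_fst (f := fun xa : {ptws quot_graph I -> X} *
      tube_prod B (quot_graph I) =>
    cpull (imfun_surj (f := cls I) (K := val K)) (xa.2 (contracted KI)))).
apply: (continuous_on_snd (f := fun a : tube_prod B (quot_graph I) =>
    cpull (imfun_surj (f := cls I) (K := val K)) (a (contracted KI)))) => a.
apply: (@continuous_comp _ _ _ (fun a : tube_prod B (quot_graph I) =>
    a (contracted KI))); last exact: cpull_continuous.
exact: proj_continuous.
Qed.

(** The form needed when the points over which the blocks are inserted are fixed. *)
Lemma compose_continuous_base (x : quot_graph I -> X) :
  continuous (fun z : tube_prod B (quot_graph I) * blocks_tube_prod F I =>
    compose ε x z.1 z.2).
Proof.
move=> z; apply: (@continuous_comp _ Z _ (fun z : tube_prod B (quot_graph I) *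
  blocks_tube_prod F I => ((x : {ptws quot_graph I -> X}, z.1), z.2))
  (fun z : Z => compose ε z.1.1 z.1.2 z.2)); last exact: compose_jointly_continuous.
move: z; apply: continuous_into_pair; last by move=> z; exact: cvg_snd.
by apply: continuous_into_pair => z; [exact: cvg_cst|exact: cvg_fst].
Qed.

End compose_continuity.

(** One variable at a time is moved from its set into the closure. *)
Lemma closure_image_pair (X Z : topologicalType) (I : finType)
    (Y : I -> topologicalType) (f : X * prod_topology Y -> Z)
    (A : set X) (B : forall i, set (Y i)) (C : set Z) :
  continuous f ->
  (forall x y, A x -> (forall i, B i (y i)) -> closure C (f (x, y))) ->
  forall x y, closure A x -> (forall i, closure (B i) (y i)) -> closure C (f (x, y)).
Proof.
move=> cf fABC x y clx cly.
have clC D : closure (closure C) D -> closure C D.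
  by rewrite -(closure_id _).1//; exact: closed_closure.
have {fABC} fBC (y' : prod_topology Y) : (forall i, B i (y' i)) -> closure C (f (x, y')).
  move=> By'; apply: clC.
  apply: (@closure_image _ _ (fun x' => f (x', y')) A) clx => [x'|x' Ax'].
    apply: (@continuous_comp _ _ _ (fun x' => (x', y') : X * prod_topology Y) f);
      last exact: cf.
    by apply: (@continuous_into_pair X X (prod_topology Y) id (fun=> y')) => z;
      [exact: cvg_id|exact: cvg_cst].
  exact: fABC.
(* Induction on the list of variables that may still lie in the closure only. *)
have H (s : seq I) (y' : prod_topology Y) :
    (forall i, closure (B i) (y' i)) -> (forall i, i \notin s -> B i (y' i)) ->
    closure C (f (x, y')).
  elim: s y' => [|j s IHs] y' cly' By'; first by apply: fBC => i; exact: By'.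
  apply: clC.
  have -> : y' = dfwith y' j (y' j).
    by apply: functional_extensionality_dep => i; case: dfwithP.
  apply: (@closure_image _ _ (fun u => f (x, dfwith y' j u)) (B j)) (cly' j).
    move=> u; apply: (@continuous_comp _ _ _
      (fun u => (x, dfwith y' j u) : X * prod_topology Y) f); last exact: cf.
    apply: (@continuous_into_pair _ X (prod_topology Y) (fun=> x) (dfwith y' j)).
      by move=> z; exact: cvg_cst.
    exact: dfwith_continuous.
  move=> u Bu; apply: IHs => i.
    by case: dfwithP => [|k _]; [exact: subset_closure|exact: cly'].
  case: dfwithP => [//|k jk ks]; apply: By'; rewrite inE negb_or eq_sym jk.
  by [].
by apply: (H (enum I)) => // i; rewrite mem_enum.
Qed.

Lemma nbhs_sub (Y : topologicalType) (A : set Y) (x : set_type A) (U : set (set_type A)) :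
  nbhs x U -> exists2 V, nbhs (set_val x) V & forall y : set_type A, V (set_val y) -> U y.
Proof.
move=> [_ [[V oV <-] Vx] VU]; exists V; first exact: open_nbhs_nbhs.
by move=> y; exact: VU.
Qed.

Lemma cvg_into_prod (T : Type) (Φ : set_system T) (ΦF : Filter Φ) (I : Type)
    (Y : I -> topologicalType) (f : T -> prod_topology Y) (l : prod_topology Y) :
  (forall i, f e i @[e --> Φ] --> l i) -> f @ Φ --> l.
Proof.
move=> fl; apply/cvg_sup => i U [_ [[V oV <-] Vl] VU].
have ΦV : Φ ((fun e => f e i) @^-1` V) by apply: fl; exact: open_nbhs_nbhs.
suff : Φ (f @^-1` U) by [].
by apply: filterS ΦV => e Ve; exact: VU.
Qed.

Section partial_limits.
Context {T : Type} {Φ : set_system T} {ΦF : ProperFilter Φ} (P : set T).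

(** Convergence of a function defined only where [P] holds.  The points built
    from a configuration carry a proof that adjacent vertices are apart, and
    this is true only for small parameters. *)
Definition tends (Y : topologicalType) (r : forall e, P e -> Y) (l : Y) :=
  forall U, nbhs l U -> \forall e \near Φ, forall h : P e, U (r e h).

Lemma tends_closure (Y : topologicalType) (r : forall e, P e -> Y) (l : Y) (A : set Y) :
  Φ P -> (forall e h, A (r e h)) -> tends r l -> closure A l.
Proof.
move=> ΦP rA rl U /rl ΦU.
have [e [Pe Ue]] := filter_ex (filterI ΦP ΦU).
by exists (r e Pe); split; [exact: rA|exact: Ue].
Qed.

Lemma tends_pair (Y Z : topologicalType) (r : forall e, P e -> Y * Z) (l : Y * Z) :
  tends (fun e h => (r e h).1) l.1 -> tends (fun e h => (r e h).2) l.2 -> tends r l.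
Proof.
move=> r1 r2 U [[A1 A2] /= [/r1 Φ1 /r2 Φ2] AU].
by apply: filterS2 Φ1 Φ2 => e A1e A2e h; apply: AU; split; [exact: A1e|exact: A2e].
Qed.

Lemma tends_prod (I : Type) (Y : I -> topologicalType)
    (r : forall e, P e -> prod_topology Y) (l : prod_topology Y) :
  (forall i, tends (fun e h => r e h i) (l i)) -> tends r l.
Proof.
move=> rl.
(* Extend [r] by its limit, so that the product topology can be used. *)
pose g e : prod_topology Y := if pselect (P e) is left h then r e h else l.
have gl : g @ Φ --> l.
  apply: cvg_into_prod => i U nU; have := rl i U nU; apply: filterS => e Ue.
  by rewrite /g /=; case: pselect => h; [exact: Ue|exact: nbhs_singleton].
move=> U /gl ΦU; apply: (filterS _ (ΦU : Φ (g @^-1` U))) => e.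
rewrite /g /=; case: pselect => // h Ue h'.
by rewrite (Prop_irrelevance h' h).
Qed.

Lemma tends_comp (Y Z : topologicalType) (f : Y -> Z) (r : forall e, P e -> Y) (l : Y) :
  continuous f -> tends r l -> tends (fun e h => f (r e h)) (f l).
Proof. by move=> cf rl U /cf /rl. Qed.

Lemma tends_sub (Y : topologicalType) (A : set Y)
    (r : forall e, P e -> set_type A) (l : set_type A) :
  tends (fun e h => set_val (r e h)) (set_val l) -> tends r l.
Proof.
move=> rl U /nbhs_sub[V /rl ΦV VU].
by apply: filterS ΦV => e Ve h; apply: VU; exact: Ve.
Qed.

Lemma tends_ptws (S : finType) (Y : topologicalType) (z : T -> S -> Y)
    (r : forall e, P e -> {ptws S -> Y}) (l : {ptws S -> Y}) :
  (forall e h s, r e h s = z e s) -> (forall s, z e s @[e --> Φ] --> l s) -> tends r l.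
Proof.
move=> rz zl; apply: tends_prod => s W /(zl s) ΦW.
apply: (filterS _ (ΦW : Φ ((fun e => z e s) @^-1` W))) => e We h.
by rewrite rz.
Qed.

End partial_limits.

(** * Configurations near a degenerate one *)

Lemma near_neq (T : Type) (Φ : set_system T) (ΦF : Filter Φ) (Y : topologicalType)
    (f g : T -> Y) (a b : Y) :
  hausdorff_space Y -> f @ Φ --> a -> g @ Φ --> b -> a <> b ->
  \forall e \near Φ, f e <> g e.
Proof.
rewrite open_hausdorff => hY fa gb /eqP /hY [[U V] /= [aU bV] [oU oV UV]].
have ΦU : Φ (f @^-1` U).
  by apply: fa; apply: open_nbhs_nbhs; split=> //; exact: set_mem.
have ΦV : Φ (g @^-1` V).
  by apply: gb; apply: open_nbhs_nbhs; split=> //; exact: set_mem.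
apply: filterS2 ΦU ΦV => e Ue Ve fg.
suff : (U `&` V) (f e) by move/eqP: UV => ->.
by split=> //; rewrite fg.
Qed.

Definition conf_pt (Γ : graph) (Y : Type) (z : {ptws Γ -> Y}) (h : conf z) :
  set_type (@conf Γ Y) := SigSub (mem_set h).

Lemma near_conf (T : Type) (Φ : set_system T) (ΦF : Filter Φ) (Γ : graph)
    (Y : Type) (z : T -> Γ -> Y) :
  (forall v w, edge v w -> \forall e \near Φ, z e v <> z e w) ->
  \forall e \near Φ, @conf Γ Y (z e).
Proof.
move=> zvw; rewrite /conf.
apply: filter_forall => v; apply: filter_forall => w.
have [vw|_] := boolP (edge v w); last exact: nearW.
by have := zvw v w vw; apply: filterS.
Qed.

Definition spread (Γ : graph) (I : tpart Γ) (Y : Type)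
    (y : forall G : block I, induced_graph (block_tube G) -> Y) (v : Γ) : Y :=
  y (cls I v) (exist _ v (mem_cls I v)).

Lemma spreadE (Γ : graph) (I : tpart Γ) (Y : Type)
    (y : forall G : block I, induced_graph (block_tube G) -> Y)
    (G : block I) (v : induced_graph (block_tube G)) :
  spread y (val v) = y G v.
Proof.
case: v => v vG; have /cls_eqP E := vG; subst G; rewrite /spread /=.
by congr (y _ _); exact: val_inj.
Qed.

Lemma spread_neq (Γ : graph) (I : tpart Γ) (Y : Type)
    (y : forall G : block I, induced_graph (block_tube G) -> Y)
    (yc : forall G, conf (y G)) (v w : Γ) :
  edge v w -> cls I v = cls I w -> spread y v <> spread y w.
Proof.
move=> vw vwE; have wv : w \in val (cls I v) by rewrite vwE mem_cls.
rewrite (spreadE y (exist _ v (mem_cls I v) : induced_graph (block_tube (cls I v)))).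
rewrite (spreadE y (exist _ w wv : induced_graph (block_tube (cls I v)))).
by apply: yc.
Qed.

Lemma conf_cls_neq (Γ : graph) (I : tpart Γ) (Y : Type) (x : quot_graph I -> Y) (v w : Γ) :
  conf x -> edge v w -> cls I v <> cls I w -> x (cls I v) <> x (cls I w).
Proof. by move=> xc /(@cls_edge _ I)[//|/xc]. Qed.

(** * Spheres of directions and the contractad FM_d *)

Section spheres.
Variables (R : realType).

Definition sph_coeff (d : nat) : coeff.
Proof.
refine (@Coeff (fun S => sph 'rV[R]_d S) (@sph_pull R 'rV[R]_d)
  (@sph_pull_continuous R d) _ _).
- by move=> S T U p q ps qs rs w; exact: sph_pull_comp.
- by move=> S ids w; exact: sph_pull_id.
Defined.

Lemma sph_class_continuous d (S : finType) : continuous (@sph_class R 'rV[R]_d S).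
Proof. exact: pi_continuous. Qed.

Lemma tends_sph_class d (S : finType) (T : Type) (Φ : set_system T)
    (ΦF : ProperFilter Φ) (P : set T) (z : T -> S -> 'rV[R]_d)
    (w : forall e, P e -> ncfg 'rV[R]_d S) (l : ncfg 'rV[R]_d S) :
  (forall e h, val (w e h) = z e) -> (forall s, z e s @[e --> Φ] --> val l s) ->
  tends (Φ := Φ) (fun e h => sph_class (w e h)) (sph_class l : sph_coeff d S).
Proof.
move=> wz zl; apply: tends_comp; first exact: sph_class_continuous.
by apply/tends_sub/(tends_ptws _ zl) => e h s; rewrite -wz.
Qed.

(** The direction of a cluster x + e y is that of y, whatever its size e. *)
Lemma sph_class_line d (S : finType) (x : ncfg 'rV[R]_d S) (y : ncfg 'rV[R]_d S)
    (e : R) (c : 'rV[R]_d) :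
  0 < e -> (forall s, val y s = c + e *: val x s) -> sph_class y = sph_class x.
Proof.
move=> e0 yx; apply/esym/sph_classP/asboolP; exists e => //; exists c => s.
by rewrite yx addrC.
Qed.

End spheres.

Section FMd_contractad.
Variables (R : realType) (d : nat).
Local Notation V := 'rV[R]_d.
Local Notation P := (FMd R d).

Definition block_vals (Γ : graph) (I : tpart Γ) (b : blocks_prod P I) :
    blocks_tube_prod (sph_coeff R d) I := fun G => val (b G).

Lemma block_vals_continuous (Γ : graph) (I : tpart Γ) :
  continuous (@block_vals Γ I).
Proof.
apply: continuous_into_prod => G b.
apply: (@continuous_comp _ _ _ (fun b : blocks_prod P I => b G) set_val).
  exact: proj_continuous.
exact: set_val_continuous.
Qed.

(** The base space can be any inhabited type, since [trivial_exc]
    is constant in its base point. *)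
Definition FMd_compose (Γ : graph) (I : tpart Γ) :=
  @compose bool _ _ (trivial_exc bool (sph_coeff R d)) Γ I (fun=> true).

(** The composite of two configurations is the limit, as e > 0 tends to 0, of
    the configurations x_G + e y_v (v in G). *)
Lemma FMd_insertion (Γ : graph) (I : tpart Γ) (x : set_type (@conf (quot_graph I) V))
    (y : forall G : block I, set_type (@conf (induced_graph (block_tube G)) V)) :
  @FMd_space R d Γ (FMd_compose (FMd_rho x) (fun G => FMd_rho (y G))).
Proof.
pose yy := spread (fun G => val (y G) : induced_graph (block_tube G) -> V).
pose z (e : R) v := val x (cls I v) + e *: yy v.
have zx v : z e v @[e --> (0 : R)^'+] --> val x (cls I v).
  apply: cvg_at_right_filter; rewrite -[X in _ --> X]addr0 -[X in _ + X](scale0r (yy v)).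
  by apply: cvgD; [exact: cvg_cst|apply: cvgZr_tmp; exact: cvg_id].
have zconf : \forall e \near (0 : R)^'+, conf (z e).
  apply: near_conf => v w vw.
  have [E|/eqP E] := eqVneq (cls I v) (cls I w); last first.
    apply: near_neq (zx v) (zx w) _; first exact: norm_hausdorff.
    by apply: conf_cls_neq => //; exact: (set_mem (valP x)).
  have yvw : yy v <> yy w.
    by apply: spread_neq vw E => G; exact: (set_mem (valP (y G))).
  near=> e; rewrite /z E => /addrI zE; apply: yvw; apply: scalerI zE.
  by rewrite gt_eqF//; near: e; exact: nbhs_right_gt.
apply: (tends_closure (Φ := (0 : R)^'+)
  (r := fun e (h : conf (z e)) => FMd_rho (conf_pt h)) zconf).
  by move=> e h; exists (conf_pt h).
apply: tends_prod => K.
have [/existsP[G KG]|KI] := boolP (in_block I K); last first.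
  rewrite /FMd_compose (compose_out _ _ _ _ KI) /= sph_pullE.
  apply: (@tends_sph_class R d _ R (0 : R)^'+ _ (fun e => conf (z e))
    (fun e s => z e (val s))
    (fun e h => mk_ncfg (conf_nonconstant K (set_mem (valP (conf_pt h))))));
    [by []|by move=> s; exact: zx].
rewrite /FMd_compose (@compose_in _ _ _ _ _ _ _ _ _ _ G KG) /= sph_pullE.
(* Inside a block the direction does not depend on [e]. *)
move=> U /nbhs_singleton Ul; near=> e => h.
rewrite /FMd_rho; set w := sph_class _.
suff -> : w = sph_class (ncfg_pull (sub_tube_fun_surj (G := block_tube G) KG)
    (mk_ncfg (conf_nonconstant (sub_tube (G := block_tube G) KG)
                               (set_mem (valP (y G)))))).
  exact: Ul.
apply: (@sph_class_line _ _ _ _ _ e (val x G)).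
  by near: e; exact: nbhs_right_gt.
move=> s /=; rewrite /z.
have vG := fintype.subsetP KG _ (valP s); have /cls_eqP -> := vG.
by rewrite -(spreadE (fun G => val (y G) : induced_graph (block_tube G) -> V)).
Unshelve. all: by end_near. Qed.

Lemma FMd_compose_continuous (Γ : graph) (I : tpart Γ) :
  continuous (fun ab : FMd_ambient R d (quot_graph I) *
                       blocks_tube_prod (sph_coeff R d) I =>
    FMd_compose ab.1 ab.2 : FMd_ambient R d Γ).
Proof.
exact (@compose_continuous_base bool _ _ (trivial_exc bool (sph_coeff R d)) Γ I
  (fun=> true)).
Qed.

Lemma FMd_compose_closed (Γ : graph) (I : tpart Γ)
    (a : P (quot_graph I)) (b : blocks_prod P I) :
  @FMd_space R d Γ (FMd_compose (val a) (block_vals b)).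
Proof.
apply: (@closure_image_pair _ _ _ _ _ (range (@FMd_rho R d (quot_graph I)))
  (fun G : block I => range (@FMd_rho R d (induced_graph (block_tube G)))) _
  (@FMd_compose_continuous Γ I)).
- move=> _ y [x _ <-] yr.
  rewrite (_ : y = fun G => FMd_rho (s2val (cid2 (yr G)))); first exact: FMd_insertion.
  by apply: functional_extensionality_dep => G; rewrite (s2valP' (cid2 (yr G))).
- exact: (set_mem (valP a)).
- by move=> G; exact: (set_mem (valP (b G))).
Qed.

Definition FMd_mul : action P P := fun Γ I a b =>
  SigSub (mem_set (@FMd_compose_closed Γ I a b)).

Lemma FMd_mul_continuous : action_continuous FMd_mul.
Proof.
move=> Γ I; apply: continuous_into_sub => z.
apply: (@continuous_comp _ _ _ (fun z : P (quot_graph I) * blocks_prod P I =>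
    (val z.1, block_vals z.2)) (fun ab : FMd_ambient R d (quot_graph I) *
      blocks_tube_prod (sph_coeff R d) I => FMd_compose ab.1 ab.2));
  last exact: FMd_compose_continuous.
move: z; apply: continuous_into_pair.
  exact: (continuous_on_fst (@set_val_continuous _ _)).
exact: (continuous_on_snd (@block_vals_continuous _ _)).
Qed.

Definition FMd_unit : P graph1.
Proof.
have x1 : @conf graph1 V (fun=> 0) by [].
refine (SigSub (mem_set
  (subset_closure _ : @FMd_space R d graph1 (FMd_rho (conf_pt x1))))).
by exists (conf_pt x1).
Defined.

Lemma FMd_mul_equivariant : action_equivariant FMd_mul.
Proof.
move=> Γ Δ f I a b; apply: val_inj.
exact: (@compose_equivariant bool _ _ (trivial_exc bool (sph_coeff R d)) _ _ f I).
Qed.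

Lemma FMd_mul_associative : action_associative FMd_mul FMd_mul.
Proof.
move=> Γ I J a b c; apply: val_inj.
exact: (@compose_associative bool _ _ (trivial_exc bool (sph_coeff R d)) _ I J).
Qed.

Lemma FMd_mul_unitr : action_unital FMd_mul FMd_unit.
Proof.
move=> Γ a; apply: val_inj.
exact: (@compose_unitr bool _ _ (trivial_exc bool (sph_coeff R d)) Γ).
Qed.

Lemma FMd_mul_unitl (Γ : graph) (b : P Γ) :
  FMd_mul (gmap (ptop_iso Γ) FMd_unit)
    (fun G : block (ptop Γ) => gmap (ptop_induced_iso G) b) = b.
Proof.
apply: val_inj; apply: functional_extensionality_dep => K.
exact: (@compose_unitl bool _ _ (trivial_exc bool (sph_coeff R d)) Γ).
Qed.

Definition FMd_contractad : contractad P :=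
  @Contractad P FMd_unit FMd_mul FMd_mul_continuous FMd_mul_equivariant
    FMd_mul_associative FMd_mul_unitr FMd_mul_unitl.

Lemma units_exceptE (C : contractad P) (Γ : graph) (G : tube Γ)
    (b : P (induced_graph G)) (H : block (psingle G)) (HG : val H = val G) :
  val (units_except (cunit C) b H) =
  relabel (B := sph_coeff R d) (induced_eq_giso (A := block_tube H) (B := G) HG) (val b).
Proof.
(* Freeing the index of the case analysis makes its elimination well typed. *)
have cases c (p : alt_spec (val H == val G) (val H == val G) c) :
    val (match p with
         | AltTrue HG' =>
             gmap (induced_eq_giso (A := block_tube H) (B := G) (eqP HG')) b
         | AltFalse HG' => gmap (iso1 (psingle_card HG')) (cunit C)
         end : P _) =
    relabel (B := sph_coeff R d) (induced_eq_giso (A := block_tube H) (B := G) HG)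
      (val b).
  by case: p => [HG'|/eqP//]; rewrite (Prop_irrelevance (eqP HG') HG).
exact: cases.
Qed.

Lemma FMd_contractad_natural : FMd_natural FMd_contractad.
Proof.
move=> Γ G a b /=; split=> K KG.
  apply: (@compose_single_in bool _ _ (trivial_exc bool (sph_coeff R d))).
  by move=> H HG; exact: (units_exceptE FMd_contractad b HG).
exact: (@compose_single_out bool _ _ (trivial_exc bool (sph_coeff R d))).
Qed.

End FMd_contractad.

(** * The exceptional divisor in charts *)

Lemma sph_pull_push (R : realType) (E F : lmodType R) (S T : finType) (p : S -> T)
    (ps : onto p) (f : {linear E -> F}) (fi : injective f) (u : sph E T) :
  sph_pull ps (sph_push fi u) = sph_push fi (sph_pull ps u).
Proof.
have [x <-] := sph_class_surj u; rewrite sph_pushE !sph_pullE sph_pushE.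
by congr sph_class; exact: val_inj.
Qed.

(** Two representatives of a direction differ by a positive scaling and a
    translation, which is a homeomorphism of the space of nonconstant
    configurations; so the saturation of an open set is open. *)
Lemma sph_class_open (R : realType) d (S : finType) (U : set (ncfg 'rV[R]_d S)) :
  open U -> open (@sph_class R 'rV[R]_d S @` U).
Proof.
move=> oU; rewrite /open /= /quotient_open.
have ncP (l : R) (t : 'rV[R]_d) (l0 : l != 0) (x : ncfg 'rV[R]_d S) :
    nonconstant (fun s => l *: val x s + t).
  have [s [s' ss']] := ncfgP x; exists s, s' => /addIr/(scalerI l0).
  exact: ss'.
pose mv l t l0 (x : ncfg 'rV[R]_d S) := mk_ncfg (ncP l t l0 x).
have cm (l : R) (t : 'rV[R]_d) s :
    continuous (fun y : {ptws S -> 'rV[R]_d} => l *: y s + t).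
  move=> y; apply: (@cvgD _ _ _ (nbhs y)); last exact: cvg_cst.
  apply: (@cvgZ _ _ _ (nbhs y)); first exact: cvg_cst.
  exact: (@proj_continuous S (fun=> 'rV[R]_d) s y).
have cmv l t l0 : continuous (mv l t l0).
  apply: continuous_into_sub; apply: continuous_into_prod => s x.
  apply: (@continuous_comp _ _ _ set_val (fun y : {ptws S -> 'rV[R]_d} => l *: y s + t)).
    exact: set_val_continuous.
  exact: cm.
rewrite openE => y /= [x Ux xy].
have /sph_classP/asboolP[l l0 [t yx]] := esym xy.
have l1 : l != 0 by rewrite gt_eqF.
have mvx : mv l t l1 y = x by apply: val_inj; apply/funext => s /=; rewrite yx.
have nU : nbhs (mv l t l1 y) U by rewrite mvx; exact: open_nbhs_nbhs.
have nU' : nbhs y (mv l t l1 @^-1` U) by exact: cmv nU.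
apply: filterS nU' => y' Uy'; exists (mv l t l1 y') => //.
apply/sph_classP; apply/asboolP; exists l^-1; first by rewrite invr_gt0.
exists (- (l^-1 *: t)) => s /=.
by rewrite scalerDr scalerA mulVf// scale1r addrK.
Qed.

Section blowups.
Variables (R : realType) (d : nat) (M : manifold R d).

Definition blowup_coeff : coeff.
Proof.
refine (@Coeff (fun S => blowup M S) (@bl_pull R d M) (@bl_pull_continuous R d M) _ _).
- by move=> S T U p q ps qs rs w; exact: bl_pull_comp.
- by move=> S ids w; exact: bl_pull_id.
Defined.

Lemma BlOff_continuous (S : finType) :
  continuous (BlOff : set_type (@nonconstant S M) -> blowup M S).
Proof. by apply/continuousP => A [A0 _]. Qed.

(** Neighbourhoods can be tested in any one chart: by definition an open set of
    the blow-up is cut out by an open set in each chart. *)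
Lemma nbhs_blowup (S : finType) (z : blowup M S) (i : mf_index M) yw
    (U : set (blowup M S)) :
  nbhs z U -> bl_chart i z yw ->
  exists2 W, nbhs yw W & forall z' yw', bl_chart i z' yw' -> W yw' -> U z'.
Proof.
rewrite nbhsE => -[A [[_ A1] Az] AU] zyw.
have [W oW hW] := A1 i; exists W.
  by apply: open_nbhs_nbhs; split => //; apply/(hW _ _ zyw).
by move=> z' yw' /hW z'W W'; apply: AU; apply/z'W.
Qed.

Lemma tangent_coord_inj (i : mf_index M) (p : M) (u v : tangent p) :
  cdom (mf_chart i) p -> tvec u i = tvec v i -> u = v.
Proof.
move=> ip uv; apply: val_inj; apply/funext => j.
have /asboolP[u0 uE] := tvecP u; have /asboolP[v0 vE] := tvecP v.
have [jp|jp] := pselect (cdom (mf_chart j) p); last by rewrite /= u0 ?v0.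
by rewrite /= (uE i j) // (vE i j)// uv.
Qed.

Lemma chart_nbhs (i : mf_index M) (p : M) :
  cdom (mf_chart i) p -> nbhs p (cdom (mf_chart i)).
Proof. by move=> ip; apply: open_nbhs_nbhs; split=> //; exact: cdom_open. Qed.

Lemma chart_image_nbhs (i : mf_index M) (p : M) :
  cdom (mf_chart i) p ->
  nbhs (cmap (mf_chart i) p) (cmap (mf_chart i) @` cdom (mf_chart i)).
Proof.
by move=> ip; apply: open_nbhs_nbhs; split; [exact: cimage_open|exists p].
Qed.

Lemma chart_cvg (i : mf_index M) (p : M) :
  cdom (mf_chart i) p -> {for p, continuous (cmap (mf_chart i))}.
Proof.
move=> ip; have := cmap_continuous (c := mf_chart i).
by rewrite continuous_open_subspace; [apply; exact: mem_set|exact: cdom_open].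
Qed.

Lemma cinv_cvg (i : mf_index M) (p : M) :
  cdom (mf_chart i) p -> {for cmap (mf_chart i) p, continuous (cinv (mf_chart i))}.
Proof.
move=> ip; have := cinv_continuous (c := mf_chart i).
rewrite continuous_open_subspace; last exact: cimage_open.
by apply; apply: mem_set; exists p.
Qed.

Variable τ : trivialization M.

Definition triv_coord (i : mf_index M) (p : M) (v : 'rV[R]_d) : 'rV[R]_d :=
  tvec (τ p v) i.

Lemma triv_coord_linear i p : linear (triv_coord i p).
Proof.
move=> k u v; rewrite /triv_coord -[tvec _]/(val _) linearP.
by rewrite GRing.valD GRing.valZ.
Qed.

HB.instance Definition _ i p := GRing.isLinear.Build R _ _ _ (triv_coord i p)
  (triv_coord_linear i p).

Lemma triv_coord_inj i p : cdom (mf_chart i) p -> injective (triv_coord i p).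
Proof.
move=> ip u v /(tangent_coord_inj ip); exact: (bij_inj (triv_bij τ p)).
Qed.

(** Smoothness of the trivialization is known for each fixed vector; continuity in
    both variables follows by expanding the vector in the standard basis. *)
Lemma triv_coord_continuous i (p : M) (v : 'rV[R]_d) : cdom (mf_chart i) p ->
  triv_coord i qu.1 qu.2 @[qu --> (p, v)] --> triv_coord i p v.
Proof.
move=> ip.
have E q u : triv_coord i q u = \sum_(j < d) u 0 j *: triv_coord i q (delta_mx 0 j).
  by rewrite [in LHS](row_sum_delta u) linear_sum; apply: eq_bigr => j _; rewrite linearZ.
rewrite E; under eq_fun do rewrite E.
apply: cvg_big => [|j _]; first exact: add_continuous.
apply: cvgZ.
  apply: (@cvg_comp _ _ _ snd (fun u : 'rV[R]_d => u 0 j) _ (nbhs v)).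
    exact: cvg_snd.
  exact: coord_continuous.
apply: (@cvg_comp _ _ _ fst (fun q => triv_coord i q (delta_mx 0 j)) _ (nbhs p)).
  exact: cvg_fst.
(* The part of smoothness of order 0 is continuity in the chart. *)
have := triv_smooth τ i (delta_mx 0 j) 0%N; move=> /(_ (cmap (mf_chart i) p)) /=.
move=> /(_ (ex_intro2 _ _ p ip erefl)) tc.
have : triv_coord i (cinv (mf_chart i) (cmap (mf_chart i) q)) (delta_mx 0 j)
    @[q --> p] --> triv_coord i p (delta_mx 0 j).
  have -> : triv_coord i p (delta_mx 0 j) =
      triv_coord i (cinv (mf_chart i) (cmap (mf_chart i) p)) (delta_mx 0 j).
    by rewrite cmapK.
  apply: (@cvg_comp _ _ _ (cmap (mf_chart i))
    (fun y => triv_coord i (cinv (mf_chart i) y) (delta_mx 0 j)) _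
    (nbhs (cmap (mf_chart i) p))); first exact: chart_cvg.
  exact: tc.
apply: cvg_trans; apply: near_eq_cvg.
by near=> q; rewrite cmapK//; near: q; exact: chart_nbhs.
Unshelve. all: by end_near. Qed.

(** The point over [p] of the exceptional divisor, identified with M × S(W) by the
    trivialization. *)
Definition exc_point (S : finType) (p : M) (u : sph 'rV[R]_d S) : blowup M S :=
  BlExc p (sph_push (bij_inj (triv_bij τ p)) u).

Lemma triv_coord_nonconstant i p (ip : cdom (mf_chart i) p) (S : finType)
    (x : ncfg 'rV[R]_d S) : nonconstant (triv_coord i p \o val x).
Proof.
by have [s [s' ss']] := ncfgP x; exists s, s' => /(triv_coord_inj ip)/ss'.
Qed.

Lemma bl_chart_exc_point i p (ip : cdom (mf_chart i) p) (S : finType)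
    (x : ncfg 'rV[R]_d S) :
  bl_chart i (exc_point p (sph_class x))
    ((fun=> cmap (mf_chart i) p), sph_class (mk_ncfg (triv_coord_nonconstant ip x))).
Proof.
rewrite /exc_point sph_pushE; split=> //; exists (τ p \o val x); split.
  by exists (ncfg_push (bij_inj (triv_bij τ p)) x).
by exists (mk_ncfg (triv_coord_nonconstant ip x)).
Qed.

Lemma exc_point_pull (S T : finType) (p : S -> T) (ps : onto p) q u :
  bl_pull ps (exc_point q u) = exc_point q (sph_pull ps u).
Proof. by rewrite /exc_point /= sph_pull_push. Qed.

(** In a chart the map sends (p, class of x) to the class of the coordinates of
    the tangent vectors at p given by x, which is continuous in (p, x).  The
    sphere is a quotient of the space of the x, and openness of the quotient map
    gives the neighbourhood of the class from one of the representative. *)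
Lemma exc_point_continuous (S : finType) :
  continuous (fun z : M * sph 'rV[R]_d S => exc_point z.1 z.2).
Proof.
move=> [p u] U /=; have [x <-] := sph_class_surj u.
have [i ip] := mf_cover p.
move=> /nbhs_blowup/(_ (bl_chart_exc_point ip x))[W [/= [W1 W2] [/= nW1 nW2] W12] WU].
have /nbhs_sub[W3 nW3 W3W] := sph_class_continuous nW2.
pose h (qy : M * {ptws S -> 'rV[R]_d}) : {ptws S -> 'rV[R]_d} :=
  fun s => triv_coord i qy.1 (qy.2 s).
have hc : h @ nbhs (p, val x : {ptws S -> 'rV[R]_d}) --> h (p, val x).
  apply: cvg_into_prod => s.
  have cs : continuous (fun qy : M * {ptws S -> 'rV[R]_d} => (qy.1, qy.2 s)).
    apply: continuous_into_pair => [z|]; first exact: cvg_fst.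
    exact: (@continuous_on_snd _ _ _ (fun y : {ptws S -> 'rV[R]_d} => y s)
      (@proj_continuous S (fun=> 'rV[R]_d) s)).
  apply: (@cvg_comp _ _ _ (fun qy : M * {ptws S -> 'rV[R]_d} => (qy.1, qy.2 s))
    (fun qu => triv_coord i qu.1 qu.2) _ (nbhs (p, val x s))).
    exact: (cs (p, val x : {ptws S -> 'rV[R]_d})).
  exact: triv_coord_continuous.
have [[N1 N2] /= [nN1 nN2] N12] := hc _ nW3.
pose N1' := (N1 `&` cdom (mf_chart i)) `&`
  (cmap (mf_chart i) @^-1` [set y | W1 (fun=> y)]).
pose N2' : set (ncfg 'rV[R]_d S) := set_val @^-1` N2°.
have cc : continuous (fun y : 'rV[R]_d => (fun=> y) : {ptws S -> 'rV[R]_d}).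
  by apply: continuous_into_prod => s y; exact: cvg_id.
exists (N1', @sph_class R 'rV[R]_d S @` N2') => /=.
  split.
    apply: filterI; first by apply: filterI => //; exact: chart_nbhs.
    exact: chart_cvg (cc _ _ nW1).
  have oN : open (@sph_class R 'rV[R]_d S @` N2').
    apply: sph_class_open.
    have /continuousP := @set_val_continuous _ (@nonconstant S 'rV[R]_d).
    by apply; exact: open_interior.
  have xN : (@sph_class R 'rV[R]_d S @` N2') (sph_class x) by exists x => //; exact: nN2.
  exact (open_nbhs_nbhs (conj oN xN)).
move=> [q _] /= [[[N1q iq] W1q] [y /interior_subset N2y <-]].
apply: WU (bl_chart_exc_point iq y) _.
apply: W12; split => //=; apply: W3W; exact: (N12 (q, val y)).
Qed.

End blowups.

(** * The module FM_M *)

Section FMM_module.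
Variables (R : realType) (d : nat) (M : manifold R d) (τ : trivialization M).
Local Notation V := 'rV[R]_d.
Local Notation P := (FMd R d).
Local Notation ch := (@mf_chart R d M).

Definition exc_divisor : exceptional M (sph_coeff R d) (blowup_coeff M) :=
  @Exceptional _ (sph_coeff R d) (blowup_coeff M) (@exc_point R d M τ)
    (@exc_point_pull R d M τ) (@exc_point_continuous R d M τ).

Definition FMM_compose (Γ : graph) (I : tpart Γ) (a : FMM_ambient M (quot_graph I))
    (b : blocks_tube_prod (sph_coeff R d) I) : FMM_ambient M Γ :=
  (a.1 \o cls I, compose exc_divisor a.1 a.2 b).

Lemma FMM_compose_continuous (Γ : graph) (I : tpart Γ) :
  continuous (fun ab : FMM_ambient M (quot_graph I) *
                       blocks_tube_prod (sph_coeff R d) I =>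
    FMM_compose ab.1 ab.2).
Proof.
apply: continuous_into_pair; last first.
  exact (@compose_jointly_continuous M _ _ exc_divisor Γ I).
have c1 : continuous (fun a : {ptws quot_graph I -> M} * FMM_blowups M (quot_graph I) =>
    a.1 \o cls I : {ptws Γ -> M}).
  exact: (continuous_on_fst (@ptws_comp_continuous Γ (quot_graph I) M (cls I))).
exact (continuous_on_fst c1).
Qed.

(** The composite of a configuration on M with configurations in R^d is the limit
    of clusters: in a chart around x_G, the points of the block G are
    x_G + e w_v, where w_v are the coordinates of the tangent vectors τ(y_v).
    Distinct y_v in a block give distinct w_v since τ and the chart coordinates
    of tangent vectors are injective. *)
Lemma FMM_insertion (Γ : graph) (I : tpart Γ) (x : set_type (@conf (quot_graph I) M))
    (y : forall G : block I, set_type (@conf (induced_graph (block_tube G)) V)) :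
  @FMM_space R d M Γ (FMM_compose (FMM_rho x) (fun G => FMd_rho (y G))).
Proof.
pose yy := spread (fun G => val (y G) : induced_graph (block_tube G) -> V).
have /choice[i xi] : forall G : quot_graph I, exists i, cdom (ch i) (val x G).
  by move=> G; exact: mf_cover.
pose p v := val x (cls I v).
pose j v := i (cls I v).
have pj v : cdom (ch (j v)) (p v) by exact: xi.
pose w v : V := triv_coord τ (j v) (p v) (yy v).
pose c (e : R) v : V := cmap (ch (j v)) (p v) + e *: w v.
pose z (e : R) v := cinv (ch (j v)) (c e v).
have c_cvg v : c e v @[e --> (0 : R)^'+] --> cmap (ch (j v)) (p v).
  apply: cvg_at_right_filter; rewrite -[X in _ --> X]addr0 -[X in _ + X](scale0r (w v)).
  by apply: cvgD; [exact: cvg_cst|apply: cvgZr_tmp; exact: cvg_id].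
have z_cvg v : z e v @[e --> (0 : R)^'+] --> p v.
  rewrite -[X in _ --> X](cmapK (pj v)).
  by apply: (cvg_comp _ _ (c_cvg v)); exact: cinv_cvg.
have c_in : \forall e \near (0 : R)^'+,
    forall v, (cmap (ch (j v)) @` cdom (ch (j v))) (c e v).
  by apply: filter_forall => v; exact: (c_cvg v _ (chart_image_nbhs (pj v))).
have e_gt0 : \forall e \near (0 : R)^'+, 0 < e by exact: nbhs_right_gt.
have zc e v : (cmap (ch (j v)) @` cdom (ch (j v))) (c e v) ->
    cdom (ch (j v)) (z e v) /\ cmap (ch (j v)) (z e v) = c e v.
  by move=> [q qj qE]; rewrite /z -qE cmapK.
have zconf : \forall e \near (0 : R)^'+, conf (z e).
  apply: near_conf => v u vu.
  have [E|/eqP E] := eqVneq (cls I v) (cls I u); last first.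
    apply: near_neq (z_cvg v) (z_cvg u) _; first exact: mf_hausdorff.
    by apply: conf_cls_neq => //; exact: (set_mem (valP x)).
  have yvu : yy v <> yy u.
    by apply: spread_neq vu E => G; exact: (set_mem (valP (y G))).
  near=> e => zE.
  have c_in' : forall v, (cmap (ch (j v)) @` cdom (ch (j v))) (c e v) by near: e.
  have e0 : e != 0 by rewrite gt_eqF//; near: e.
  have [_ cv] := zc e v (c_in' v); have [_ cu] := zc e u (c_in' u).
  have : c e v = c e u by rewrite -cv -cu zE /j E.
  rewrite /c /w /p /j E => /addrI /(scalerI e0).
  by move=> /(triv_coord_inj (xi (cls I u)))/yvu.
apply: (tends_closure (Φ := (0 : R)^'+)
  (r := fun e (h : conf (z e)) => FMM_rho (conf_pt h)) zconf).
  by move=> e h; exists (conf_pt h).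
apply: tends_pair; first exact: tends_ptws z_cvg.
apply: tends_prod => K.
have [/existsP[G KG]|KI] := boolP (in_block I K); last first.
  rewrite /FMM_compose [X in tends _ X]/= (compose_out _ _ _ _ KI) /=.
  pose r e (h : conf (z e)) : set_type (@nonconstant (ssub (val K)) M) :=
    SigSub (mem_set (conf_nonconstant K (set_mem (valP (conf_pt h))))).
  apply: (tends_comp (r := r) (@BlOff_continuous R d M _)).
  by apply/tends_sub/(tends_ptws (z := fun e s => z e (val s))) => // s; exact: z_cvg.
rewrite /FMM_compose /= (@compose_in _ _ _ _ _ _ _ _ _ _ G KG) /= sph_pullE.
set x0 := ncfg_pull _ _ => U.
have iG := xi G.
pose w0 := mk_ncfg (triv_coord_nonconstant τ iG x0).
have sG (s : ssub (val K)) : cls I (val s) = G.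
  by apply/cls_eqP; exact: (fintype.subsetP KG _ (valP s)).
have cE e (s : ssub (val K)) :
    c e (val s) = cmap (ch (i G)) (val x G) + e *: val w0 s.
  rewrite /c /w /p /j sG; congr (_ + _ *: triv_coord _ _ _ _).
  exact: (spreadE _ (sval (sub_tube_fun (G := block_tube G) KG s))).
(* Near the limit, look in the chart used for [G]: there the points off the
   diagonal are [c e], and their direction is constantly that of [w0]. *)
move=> /nbhs_blowup/(_ (bl_chart_exc_point τ iG x0))[W nW WU].
pose pt e : {ptws ssub (val K) -> V} * sph V (ssub (val K)) :=
  (fun s => c e (val s), sph_class w0).
have ptW : \forall e \near (0 : R)^'+, W (pt e).
  move: nW => [[W1 W2] /= [nW1 nW2] W12].
  pose pc e : {ptws ssub (val K) -> V} := fun s => c e (val s).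
  pose pl : {ptws ssub (val K) -> V} := fun=> cmap (ch (i G)) (val x G).
  have c_lim : pc @ (0 : R)^'+ --> pl.
    by apply: cvg_into_prod => s; have := c_cvg (val s); rewrite /p /j sG.
  have : \forall e \near (0 : R)^'+, W1 (pc e) by exact (c_lim W1 nW1).
  apply: filterS => e W1e; apply: W12; split => //=; exact: nbhs_singleton.
near=> e => h.
have e0 : 0 < e by near: e.
have ptWe : W (pt e) by near: e.
have c_in' : forall v, (cmap (ch (j v)) @` cdom (ch (j v))) (c e v) by near: e.
apply: WU ptWe; split=> [s|s|].
- by have [] := zc e (val s) (c_in' (val s)); rewrite /j sG.
- by have [] := zc e (val s) (c_in' (val s)); rewrite /j sG.
have nc : nonconstant (fun s : ssub (val K) => c e (val s)).
  have [s [s' ss']] := ncfgP w0; exists s, s'; rewrite !cE => /addrI/scalerI.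
  by move=> /(_ (lt0r_neq0 e0))/ss'.
exists (mk_ncfg nc); split=> //.
by apply: (sph_class_line e0) => s; exact: cE.
Unshelve. all: by end_near. Qed.

Lemma FMM_compose_closed (Γ : graph) (I : tpart Γ)
    (a : FMM M (quot_graph I)) (b : blocks_prod P I) :
  @FMM_space R d M Γ (FMM_compose (val a) (block_vals b)).
Proof.
apply: (@closure_image_pair _ _ _ _ _ (range (@FMM_rho R d M (quot_graph I)))
  (fun G : block I => range (@FMd_rho R d (induced_graph (block_tube G)))) _
  (@FMM_compose_continuous Γ I)).
- move=> _ y [x _ <-] yr.
  rewrite (_ : y = fun G => FMd_rho (s2val (cid2 (yr G)))); first exact: FMM_insertion.
  by apply: functional_extensionality_dep => G; rewrite (s2valP' (cid2 (yr G))).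
- exact: (set_mem (valP a)).
- by move=> G; exact: (set_mem (valP (b G))).
Qed.

Definition FMM_act : action (FMM M) P := fun Γ I a b =>
  SigSub (mem_set (@FMM_compose_closed Γ I a b)).

Lemma FMM_act_continuous : action_continuous FMM_act.
Proof.
move=> Γ I; apply: continuous_into_sub => z.
apply: (@continuous_comp _ _ _ (fun z : FMM M (quot_graph I) * blocks_prod P I =>
    (val z.1, block_vals z.2)) (fun ab : FMM_ambient M (quot_graph I) *
      blocks_tube_prod (sph_coeff R d) I => FMM_compose ab.1 ab.2));
  last exact: FMM_compose_continuous.
move: z; apply: continuous_into_pair.
  exact: (continuous_on_fst (@set_val_continuous _ _)).
exact: (continuous_on_snd (@block_vals_continuous _ _ _ _)).
Qed.

Lemma FMM_act_equivariant : action_equivariant FMM_act.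
Proof.
move=> Γ Δ f I a b; apply: val_inj; congr pair.
  by apply/funext => v; exact (congr1 (val a).1 (esym (ppull_isoE f I v))).
have := @compose_equivariant M _ _ exc_divisor _ _ f I (val a).1 (val a).2 (block_vals b).
exact.
Qed.

Lemma FMM_act_associative :
  action_associative FMM_act (cmul (FMd_contractad R d)).
Proof.
move=> Γ I J a b c; apply: val_inj; congr pair.
  by apply/funext => v; exact (congr1 (val a).1 (esym (prefine_isoE J v))).
exact: (@compose_associative M _ _ exc_divisor _ I J bool true (val a).1 (val a).2).
Qed.

Lemma FMM_act_unital : action_unital FMM_act (cunit (FMd_contractad R d)).
Proof.
move=> Γ a; apply: val_inj; rewrite [RHS]surjective_pairing; congr pair.
  by apply/funext => v; exact (congr1 (val a).1 (pdisc_isoE v)).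
exact: (@compose_unitr M _ _ exc_divisor Γ).
Qed.

Definition FMM_module : right_module (FMd_contractad R d) (FMM M) :=
  @RightModule P (FMd_contractad R d) (FMM M) FMM_act FMM_act_continuous
    FMM_act_equivariant FMM_act_associative FMM_act_unital.

Lemma FMM_module_natural : FMM_natural τ FMM_module.
Proof.
move=> Γ G a b /=; split=> [//|K KG|K KG].
  apply: (@compose_single_in M _ _ exc_divisor).
  by move=> H HG; exact: (units_exceptE (FMd_contractad R d) b HG).
exact: (@compose_single_out M _ _ exc_divisor).
Qed.

End FMM_module.

Theorem proposition3p15 (R : realType) (d : nat) (M : manifold R d)
    (M_compact : compact [set: M]) (τ : trivialization M) :
  exists C : contractad (FMd R d), FMd_natural C /\
  exists A : right_module C (FMM M), FMM_natural τ A.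
Proof.
exists (FMd_contractad R d); split; first exact: FMd_contractad_natural.
by exists (FMM_module τ); exact: FMM_module_natural.
Qed.
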